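(* Let $G$ be a graph that is not 2-paintable. Then $m(G)=2$, $3$, or $4$. More specifically: (a) $m(G)=2$ if and only if $G$ is not bipartite; (b) $m(G)=3$ if and only if $G$ is bipartite and contains a subgraph (isomorphic to a member of) $\mathfrak{F}_2\cup\mathfrak{F}_3\cup\mathfrak{F}_4$; (c) $m(G)=4$ if and only if the core of $G$ is (isomorphic to a member of) $\mathfrak{F}_5$.
   Context: All graphs are finite and simple. Let $f:V(G)\to\mathbb{Z}_{\ge 0}$. The game $(G,f)$ is played by Lister and Painter. In round $i$ Lister chooses, adaptively, a nonempty set $V_i\subseteq V(G)$ of marked vertices, and then Painter, seeing $V_1,\dots,V_i$, chooses an independent set $X_i\subseteq V_i$ whose vertices receive color $i$. A vertex that has been colored needs no further coloring, but may still be marked later. Painter wins if at the end every vertex has been colored. In the game with exactly $t$ rounds ($t$ is known to both players in advance), Lister must choose $V_1,\dots,V_t$ so that each vertex $v$ lies in exactly $f(v)$ of them; $G$ is $[f,t]$-paintable if Painter has a winning strategy in this game (vacuously true if no legal sequence of marked sets of length $t$ exists). In the unrestricted game the number of rounds is not fixed in advance and play continues until every vertex $v$ has been marked $f(v)$ times (never more); $G$ is $f$-paintable if Painter has a winning strategy in the unrestricted game. For the constant function $f\equiv k$ we say $k$-paintable and $[k,t]$-paintable. $m(G)$ is the minimum $t\ge 2$ such that $G$ is not $[2,t]$-paintable. The core of $G$ is the subgraph obtained by iteratively removing all vertices of degree 1. $P_k$ is the path with $k$ vertices and $C_n$ the cycle with $n$ vertices ($n\ge 3$). $C_m\cdot P_k\cdot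 C_n$ denotes two vertex-disjoint cycles $C_m$ and $C_n$ connected by a path $P_k$: one endpoint of $P_k$ is a vertex of $C_m$, the other endpoint is a vertex of $C_n$, and there are no other common vertices; $k=1$ is also allowed, in which case the two cycles share exactly one vertex. $\theta_{p_1,\dots,p_r}$ is the (simple) graph obtained from $r$ disjoint paths with $p_1,\dots,p_r$ edges respectively by identifying all their beginnings to one vertex and all their ends to one vertex. $\mathfrak{F}_2=\{C_m\cdot P_k\cdot C_n\}$, $\mathfrak{F}_3=\{\theta_{p,q,r}$ not isomorphic to any $\theta_{2,2,2n}$, $n\ge1\}$, $\mathfrak{F}_4=\{\theta_{2,2,2n}$ not isomorphic to $\theta_{2,2,2}\}$, $\mathfrak{F}_5=\{K_{2,n}: n\ge 4\}$.
   Formalization: In (c), the direction ''m(G)=4 implies the core of G is in F_5'' is proved for connected G only; it is false for disconnected G, e.g. K_{2,4} plus an isolated vertex has m=4 but its core is not a K_{2,n}. All other claims are proved for every G. *)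

(* Defs.v *)
From mathcomp Require Import all_boot.
Set Implicit Arguments.
Unset Strict Implicit.
Unset Printing Implicit Defensive.

(* A finite simple graph is a symmetric irreflexive [e : rel T], T : finType. *)

Definition bipartite (T : finType) (e : rel T) : Prop :=
  exists c : T -> bool, forall x y, e x y -> c x != c y.

Definition connected (T : finType) (e : rel T) : Prop :=
  forall x y, connect e x y.

Definition independent (T : finType) (e : rel T) (X : {set T}) : Prop :=
  forall x y, x \in X -> y \in X -> ~~ e x y.

Definition isomorphic (T U : finType) (e : rel T) (d : rel U) : Prop :=
  exists2 h : T -> U, bijective h & forall x y, d (h x) (h y) = e x y.

(* Not necessarily induced subgraph: e contains a copy of d. *)
Definition contains_subgraph (T U : finType) (e : rel T) (d : rel U) : Prop :=
  exists2 h : U -> T, injective h & forall x y, d x y -> e (h x) (h y).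

Definition induced (T : finType) (e : rel T) (A : {set T}) :
    rel {x : T | x \in A} :=
  fun x y => e (val x) (val y).

Arguments induced : clear implicits.
Arguments induced {T}.

(* Each non-stationary step deletes a vertex, so #|T| steps suffice.  All
   vertices of current degree 1 are deleted simultaneously; compared with
   one-at-a-time deletion this only matters for components that are trees
   (which may then vanish instead of leaving an isolated vertex). *)
Definition core_set (T : finType) (e : rel T) : {set T} :=
  iter #|T|
    (fun A : {set T} => [set v in A | #|[set w in A | e v w]| != 1]) setT.

Definition core (T : finType) (e : rel T) : rel {x : T | x \in core_set e} :=
  induced e (core_set e).

Arguments core : clear implicits.
Arguments core {T}.

(* Lister's moves are recorded as the sequence [:: V_1; ...; V_t] of marked
   sets.  A Painter strategy maps the history [:: V_1; ...; V_i] to X_i; since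
   it is deterministic, Painter's earlier moves are functions of the history,
   and it beats every adaptive Lister iff it beats every legal sequence. *)

Definition painter_strategy (T : finType) := seq {set T} -> {set T}.

Definition legal_marking (T : finType) (f : T -> nat) (Vs : seq {set T}) :
    Prop :=
  set0 \notin Vs /\
  forall v : T, count (fun V : {set T} => v \in V) Vs = f v.

Definition painter_wins_play (T : finType) (e : rel T)
    (s : painter_strategy T) (Vs : seq {set T}) : Prop :=
  (forall i, i < size Vs ->
     s (take i.+1 Vs) \subset nth set0 Vs i /\
     independent e (s (take i.+1 Vs))) /\
  (forall v : T, exists2 i, i < size Vs & v \in s (take i.+1 Vs)).

(* Unrestricted game: the strategy does not depend on the number of rounds. *)
Definition paintable (T : finType) (e : rel T) (f : T -> nat) : Prop :=
  exists s : painter_strategy T,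
    forall Vs, legal_marking f Vs -> painter_wins_play e s Vs.

Definition paintable_in (T : finType) (e : rel T) (f : T -> nat) (t : nat) :
    Prop :=
  exists s : painter_strategy T,
    forall Vs, legal_marking f Vs -> size Vs = t -> painter_wins_play e s Vs.

(* m(G) = t: the minimum is a relation, so that [m_is e t] also asserts that
   the minimum exists. *)
Definition m_is (T : finType) (e : rel T) (t : nat) : Prop :=
  [/\ 2 <= t, ~ paintable_in e (fun=> 2) t
    & forall s, 2 <= s < t -> paintable_in e (fun=> 2) s].

(* C_m . P_k . C_n (m, n >= 3, k >= 1): the first cycle lives on 0, ..., m-1,
   the path on m-1, ..., m+k-2 and the second cycle on m+k-2, ..., m+k+n-3;
   hence consecutive vertices are adjacent, and each cycle has one more edge
   closing it. *)
Definition dumbbell (m k n : nat) : rel 'I_(m + k + n - 2) :=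
  let arc (x y : nat) :=
    [|| x.+1 == y, (x == 0) && (y == m.-1)
      | (x == m + k - 2) && (y == m + k + n - 3)] in
  fun x y => arc x y || arc y x.

Arguments dumbbell : clear implicits.

(* theta_{p_1, ..., p_r} for ps = [:: p_1; ...; p_r]: the two identified
   endpoints are [inl false] and [inl true]; the i-th path has p_i - 1 inner
   vertices.  [theta_pt ps i k] is the k-th vertex (0 <= k <= p_i) of the i-th
   path after the identification. *)
Definition theta_vertex (ps : seq nat) : finType :=
  (bool + {i : 'I_(size ps) & 'I_(nth 0 ps i).-1})%type.

Definition theta_pt (ps : seq nat) (i : 'I_(size ps)) (k : nat) :
    theta_vertex ps :=
  if k is k'.+1 then
    if (insub k' : option 'I_(nth 0 ps i).-1) is Some j
    then inr (Tagged (fun i : 'I_(size ps) => 'I_(nth 0 ps i).-1) j)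
    else inl true
  else inl false.

Definition theta (ps : seq nat) : rel (theta_vertex ps) :=
  fun x y => [exists i : 'I_(size ps), exists k : 'I_(nth 0 ps i),
    ((x == theta_pt i k) && (y == theta_pt i k.+1)) ||
    ((y == theta_pt i k) && (x == theta_pt i k.+1))].

Arguments theta : clear implicits.

(* No loop and no multiple edge arises from the identification. *)
Definition theta_simple (ps : seq nat) : bool :=
  all (leq 1) ps && (count_mem 1 ps <= 1).

Definition K2 (n : nat) : rel ('I_2 + 'I_n) :=
  fun x y => is_inl x != is_inl y.

Arguments K2 : clear implicits.

Definition in_F2 (T : finType) (e : rel T) : Prop :=
  exists m k n, [/\ 3 <= m, 1 <= k, 3 <= n & isomorphic e (dumbbell m k n)].

Definition in_F3 (T : finType) (e : rel T) : Prop :=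
  exists p q r,
    [/\ theta_simple [:: p; q; r],
        isomorphic e (theta [:: p; q; r])
      & forall n, 1 <= n -> ~ isomorphic e (theta [:: 2; 2; n.*2])].

Definition in_F4 (T : finType) (e : rel T) : Prop :=
  exists n,
    [/\ 1 <= n, isomorphic e (theta [:: 2; 2; n.*2])
      & ~ isomorphic e (theta [:: 2; 2; 2])].

Definition in_F5 (T : finType) (e : rel T) : Prop :=
  exists2 n, 4 <= n & isomorphic e (K2 n).

Definition contains_F234 (T : finType) (e : rel T) : Prop :=
  exists (U : finType) (d : rel U),
    contains_subgraph e d /\ [\/ in_F2 d, in_F3 d | in_F4 d].

(* Main.v *)
Require Import Defs.
From mathcomp Require Import all_boot zify.
From Stdlib Require Import Classical.
Set Implicit Arguments.
Unset Strict Implicit.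
Unset Printing Implicit Defensive.

(** In the game with two rounds every vertex is marked twice, so Painter wins
    exactly on bipartite graphs ([paintable_in2_bipartite],
    [bipartite_paintable_in2]).  Let the graph be bipartite from now on.

    In the game with three rounds let [V] be the first marked set and [X] the
    first color class.  Afterwards the vertices outside [V] still have both
    remaining colors, whereas an uncolored vertex of [V] has just one, which
    Lister chooses.  Lister wins as soon as two uncolored vertices of [V] are
    connected outside [X].  This gives one obstruction
    ([lister_wins_three_rounds]): a connected set [V] and two vertices [w1],
    [w2] outside it, of different color classes, both with two neighbors in
    [V].  Dumbbells contain it, and so do all bipartite theta graphs except
    [theta_{2,2,2}]: remove one suitable vertex of degree 2 from each of the
    two cycles, respectively from two of the three paths.  The families
    [in_F3] and [in_F4] together consist of all theta graphs but
    [theta_{2,2,2}], so Lister wins in three rounds on every bipartite graph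
    with a subgraph in [in_F2], [in_F3] or [in_F4] ([F234_not_paintable_in3]).

    Conversely, take a bipartite graph without such a subgraph, and a set of
    vertices in which all degrees are at least 2.  An edge that leaves a cycle
    can be prolonged until it meets itself or the cycle again, which creates a
    dumbbell or a theta graph; so it is a [theta_{2,2,2}] ([ear]).  It follows
    that the components of the set are cycles and complete bipartite graphs
    [K_{2,n}] ([cycle_or_biclique]).  Thus the whole graph is built from such
    components and from vertices added with degree at most 1
    ([decomposition_ind]).  Painter can add a vertex of degree at most 1
    ([win_add_vertex]) and can treat components separately ([win_union]), in
    all versions of the game at once.  He wins on even cycles, by coloring
    kernels of the cyclic orientation ([win_orientation]), and on [K_{2,3}]
    ([biclique2_win]), for any number of rounds, and on every [K_{2,n}] in
    three rounds ([biclique2_win3]).  Hence Painter wins the game with three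
    rounds, and if the graph is not 2-paintable then it contains [K_{2,4}], on
    which Lister wins in four rounds with the classical bad list assignment
    ([lister_wins_four_rounds]).  If the graph is moreover connected then so
    is its core, which therefore is a single component [K_{2,n}]. *)

(** * Winning positions and strategies *)

Section Game.
Variables (T : finType) (e : rel T).
Implicit Types (A B V X Y : {set T}) (f : T -> nat) (c : T -> bool).

Definition stable A := [forall x in A, forall y in A, ~~ e x y].

Lemma stableP A : reflect (independent e A) (stable A).
Proof.
apply: (iffP forall_inP) => [st x y xA yA | st x xA].
  by have /forall_inP/(_ y yA) := st x xA.
by apply/forall_inP => y; apply: st.
Qed.

Definition unmark f V : T -> nat := fun v => f v - (v \in V).

(** The marking [V] leaves the vertices of [A] enough marks, and not too many,
    for [r] more rounds. *)
Definition legal_round r A f V :=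
  [forall v in A, if v \in V then 0 < f v else f v <= r].

(** Painter's winning positions: [r] rounds remain, [A] is the set of uncolored
    vertices and [f] counts the marks still to come.  Rounds without a marked
    vertex are permitted, which makes positions on unrelated parts of the graph
    independent of each other, and lets a single predicate serve both games:
    Lister ends an unrestricted play early by marking nothing any more. *)
Fixpoint win r A f : bool :=
  if r is r'.+1 then
    [forall V : {set T}, legal_round r' A f V ==>
       [exists X : {set T}, [&& X \subset A :&: V, stable X
                    & win r' (A :\: X) (unmark f V)]]]
  else [forall v in A, f v != 0].

Lemma win0P A f : reflect {in A, forall v, f v != 0} (win 0 A f).
Proof. exact: forall_inP. Qed.

Lemma winSP r A f :
  reflect (forall V, legal_round r A f V ->
             exists X, [/\ X \subset A :&: V, stable X
                         & win r (A :\: X) (unmark f V)])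
          (win r.+1 A f).
Proof.
apply: (iffP forallP) => [wins V legV | wins V].
  have /implyP/(_ legV)/existsP[X /and3P[? ? ?]] := wins V.
  by exists X.
apply/implyP => /wins[X [? ? ?]]; apply/existsP; exists X; exact/and3P.
Qed.

Lemma legal_roundP r A f V :
  reflect (forall v, v \in A -> if v \in V then 0 < f v else f v <= r)
          (legal_round r A f V).
Proof. exact: forall_inP. Qed.

Lemma legal_roundS r A B f V :
  B \subset A -> legal_round r A f V -> legal_round r B f V.
Proof.
move=> /subsetP sBA /legal_roundP legV; apply/legal_roundP => v /sBA; exact: legV.
Qed.

Lemma win_unmarked r A f : win r A f -> {in A, forall v, f v = 0} -> A = set0.
Proof.
elim: r A f => [|r IHr] A f.
  move=> /win0P fA f0; apply/setP => v; rewrite inE; apply/negP => vA.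
  by have := fA v vA; rewrite f0.
move=> /winSP wins f0.
have leg0 : legal_round r A f set0.
  by apply/legal_roundP => v vA; rewrite inE f0.
have [X [sX _ /IHr]] := wins _ leg0.
have -> : X = set0 by apply/eqP; rewrite -subset0 (subset_trans sX) ?subsetIr.
by rewrite setD0; apply => v vA; rewrite /unmark f0.
Qed.

Definition reply r A f V :=
  odflt set0 [pick X : {set T} | [&& X \subset A :&: V, stable X
                                   & win r (A :\: X) (unmark f V)]].

Lemma replyP r A f V : win r.+1 A f -> legal_round r A f V ->
  let X := reply r A f V in
  [/\ X \subset A :&: V, stable X & win r (A :\: X) (unmark f V)].
Proof.
move=> /winSP wins /wins[Y [? ? ?]].
by rewrite /reply; case: pickP => [X /and3P[] // | /(_ Y)/and3P[]].
Qed.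

(** Painter recovers the current position by replaying the history from the
    initial position [r], [A], [f]. *)
Fixpoint strategy_from r A f (h : seq {set T}) : {set T} :=
  if h is V :: h' then
    let X := reply r.-1 A f V in
    if h' is [::] then X else strategy_from r.-1 (A :\: X) (unmark f V) h'
  else set0.

Lemma strategy_from_wins r A f (Vs : seq {set T}) :
    win r A f -> size Vs <= r ->
    {in A, forall v, count (fun V : {set T} => v \in V) Vs = f v} ->
  (forall i, i < size Vs ->
     strategy_from r A f (take i.+1 Vs) \subset nth set0 Vs i /\
     independent e (strategy_from r A f (take i.+1 Vs))) /\
  {in A, forall v, exists2 i, i < size Vs
                   & v \in strategy_from r A f (take i.+1 Vs)}.
Proof.
elim: Vs r A f => [|V Vs IHVs] r A f winA.
  move=> _ /= cnt; split=> // v vA.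
  have A0 := win_unmarked winA (fun u uA => esym (cnt u uA)).
  by rewrite A0 inE in vA.
case: r winA => // r winA szVs cnt.
have legV : legal_round r A f V.
  apply/legal_roundP => v vA; rewrite -cnt //=.
  case: (v \in V) => //; rewrite add0n -ltnS.
  exact: leq_ltn_trans (count_size _ _) szVs.
have [sX stX winX] := replyP winA legV.
set X := reply r A f V in sX stX winX *.
have [v|IH1 IH2] := IHVs r _ _ winX szVs.
  by case/setDP => vA _; rewrite /unmark -cnt //= addKn.
have later i : i < size Vs -> strategy_from r.+1 A f (V :: take i.+1 Vs) =
    strategy_from r (A :\: X) (unmark f V) (take i.+1 Vs).
  by case: Vs {IHVs szVs cnt IH1 IH2}.
split=> [[|i] lti | v vA].
- rewrite /= take0; split; first exact: subset_trans sX (subsetIr _ _).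
  exact/stableP.
- by rewrite [take _ _]/= later //; apply: IH1.
have [vX|vX] := boolP (v \in X); first by exists 0; rewrite /= ?take0.
have [|i lti vi] := IH2 v; first by rewrite inE vX.
by exists i.+1; rewrite // [take _ _]/= later.
Qed.

Lemma win_paintable_in t f : win t setT f -> paintable_in e f t.
Proof.
move=> winT; exists (strategy_from t setT f) => Vs [_ cnt] szVs.
have [|v _|H1 H2] := strategy_from_wins (Vs := Vs) winT; first by rewrite szVs.
  exact: cnt.
by split=> // v; apply: H2.
Qed.

(** Since Lister marks a vertex in every round, a play of the unrestricted game
    lasts at most [\sum_v f v] rounds. *)
Lemma size_marking f Vs : legal_marking f Vs -> size Vs <= \sum_v f v.
Proof.
case=> nz cnt; have -> : \sum_v f v = \sum_(V <- Vs) #|V|.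
  rewrite (eq_bigr (fun v => \sum_(V <- Vs) (v \in V))); last first.
    by move=> v _; rewrite -cnt -sum1_count big_mkcond.
  rewrite exchange_big /=; apply: eq_bigr => V _.
  by rewrite -big_mkcond sum1_card.
rewrite -sum1_size; elim: Vs nz {cnt} => [|V Vs IH]; first by rewrite !big_nil.
rewrite inE negb_or !big_cons => /andP[V0 /IH]; apply: leq_add.
by rewrite card_gt0 eq_sym.
Qed.

Lemma win_paintable f : (forall r, win r setT f) -> paintable e f.
Proof.
move=> wins; exists (strategy_from (\sum_v f v) setT f) => Vs legVs.
have [|v _|H1 H2] := strategy_from_wins (Vs := Vs) (wins (\sum_v f v)).
- exact: size_marking.
- by case: legVs.
by split=> // v; apply: H2.
Qed.

End Game.

(** * Painter's tools *)

Section Painter.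
Variables (T : finType) (e : rel T).
Hypotheses (e_sym : symmetric e) (e_irr : irreflexive e).
Implicit Types (A B V W X Y : {set T}) (f : T -> nat) (c : T -> bool).

Definition coloring_on A c := {in A &, forall x y, e x y -> c x != c y}.

Lemma coloring_onS A B c : B \subset A -> coloring_on A c -> coloring_on B c.
Proof. by move=> /subsetP sBA col x y /sBA xA /sBA; apply: col. Qed.

(** A digraph without odd cycles has a kernel.  If every vertex of one class
    has an arc into the other class, then that other class is a kernel;
    otherwise a sink goes into the kernel and absorbs its in-neighbors. *)
Lemma bipartite_kernel (D : rel T) c W :
    {in W &, forall x y, D x y -> c x != c y} ->
  exists X, [/\ X \subset W, {in X &, forall x y, ~~ D x y}
              & {in W :\: X, forall v, exists2 w, w \in X & D v w}].
Proof.
elim: {W}#|W| {-2}W (leqnn #|W|) => [|n IHn] W.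
  rewrite leqn0 cards_eq0 => /eqP-> _; exists set0.
  by split=> [|x|x]; rewrite ?sub0set ?inE.
move=> leWn colD.
have [/forall_inP out|/forall_inPn[s /setIdP[sW cs] /exists_inPn sink]] :=
  boolP [forall s in [set s in W | ~~ c s], exists w in [set w in W | c w], D s w].
  exists [set w in W | c w]; split=> [|x y|v].
  - by apply/subsetP => x; rewrite inE => /andP[].
  - rewrite !inE => /andP[xW cx] /andP[yW cy]; apply/negP => /(colD _ _ xW yW).
    by rewrite cx cy.
  - rewrite !inE => /andP[nX vW]; rewrite vW /= in nX.
    by apply/exists_inP/out; rewrite inE vW.
have sinkW w : w \in W -> ~~ D s w.
  move=> wW; apply/negP => Dsw; have := sink w; rewrite inE wW Dsw /=.
  have := colD _ _ sW wW Dsw; rewrite (negbTE cs) /=.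
  by case: (c w) => // _ /(_ isT).
set W' := W :\: (s |: [set v | D v s]).
have sW'W : W' \subset W by apply: subsetDl.
have [||X [sX indX absX]] := IHn W'.
- rewrite -ltnS; apply: leq_trans leWn; apply: proper_card.
  rewrite properE sW'W; apply/subsetPn; exists s => //.
  by rewrite !inE eqxx.
- by move=> x y /(subsetP sW'W) xW /(subsetP sW'W) yW; apply: colD.
have sXW := subset_trans sX sW'W.
exists (s |: X); split=> [|x y|v].
- by rewrite subUset sub1set sW.
- move=> /setU1P[->|xX] /setU1P[->|yX]; [exact: sinkW| | |exact: indX].
    by rewrite sinkW ?(subsetP sXW).
  by have := subsetP sX _ xX; rewrite !inE negb_or => /andP[/andP[]].
- rewrite !inE negb_or => /andP[/andP[vs vX] vW].
  have [Dvs|nDvs] := boolP (D v s); first by exists s; rewrite ?setU11.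
  have [|w wX Dvw] := absX v; last by exists w; rewrite ?setU1r.
  by rewrite !inE (negbTE vX) (negbTE vs) (negbTE nDvs).
Qed.

(** Painter colors a kernel of the marked set: every other marked vertex loses
    an out-neighbor together with its mark. *)
Lemma win_orientation (D : rel T) c r A f :
    {in A &, forall x y, D x y -> c x != c y} ->
    {in A &, forall x y, e x y -> D x y || D y x} ->
    {in A, forall v, #|[set w in A | D v w]| < f v} ->
  win e r A f.
Proof.
elim: r A f => [|r IHr] A f colD orient out.
  by apply/win0P => v /out; rewrite -lt0n; apply: leq_ltn_trans.
apply/winSP => V _.
have sIA : A :&: V \subset A by apply: subsetIl.
have [|X [sX indX absX]] := @bipartite_kernel D c (A :&: V).
  by move=> x y /(subsetP sIA) xA /(subsetP sIA); apply: colD.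
have sXA := subset_trans sX sIA.
exists X; split=> //.
  apply/stableP => x y xX yX; apply/negP => /orient.
  rewrite !(subsetP sXA) // => /(_ isT isT).
  by rewrite (negbTE (indX _ _ xX yX)) (negbTE (indX _ _ yX xX)).
have sDA : A :\: X \subset A by apply: subsetDl.
apply: IHr => [x y /(subsetP sDA) xA|x y /(subsetP sDA) xA|v].
- by move=> /(subsetP sDA); apply: colD.
- by move=> /(subsetP sDA); apply: orient.
rewrite inE => /andP[vX vA]; rewrite /unmark.
have sub : [set w in A :\: X | D v w] \subset [set w in A | D v w].
  by apply/subsetP => w; rewrite !inE => /andP[/andP[_ ->]].
case vV: (v \in V); last first.
  by rewrite subn0; apply: leq_ltn_trans (out v vA); apply: subset_leq_card.
have [|w wX Dvw] := absX v; first by rewrite !inE vX vA.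
rewrite ltn_subRL add1n; apply: leq_trans (out v vA); rewrite ltnS.
apply: proper_card; rewrite properE sub /=; apply/subsetPn; exists w.
  by rewrite inE Dvw (subsetP sXA).
by rewrite !inE wX.
Qed.

Lemma win_stable r A f : stable e A -> {in A, forall v, 0 < f v} -> win e r A f.
Proof.
move=> /stableP stA f0.
apply: (@win_orientation (fun _ _ => false) (fun=> true)) => // [x y xA yA|v vA].
  by rewrite (negbTE (stA x y xA yA)).
rewrite (_ : [set w in A | false] = set0) ?cards0 ?f0 //.
by apply/setP => w; rewrite !inE andbF.
Qed.

Lemma win_union r A B f :
    [disjoint A & B] -> (forall x y, x \in A -> y \in B -> ~~ e x y) ->
  win e r A f -> win e r B f -> win e r (A :|: B) f.
Proof.
elim: r A B f => [|r IHr] A B f disj sep.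
  by move=> /win0P fA /win0P fB; apply/win0P => v /setUP[/fA|/fB].
move=> /winSP winA /winSP winB; apply/winSP => V legV.
have [X [sX stX wX]] := winA V (legal_roundS (subsetUl A B) legV).
have [Y [sY stY wY]] := winB V (legal_roundS (subsetUr A B) legV).
have sXA := subset_trans sX (subsetIl A V).
have sYB := subset_trans sY (subsetIl B V).
exists (X :|: Y); split.
- by rewrite setIUl setUSS.
- apply/stableP => x y.
  move: stX stY => /stableP stX /stableP stY.
  case/setUP=> [xX|xY] /setUP[yX|yY]; [exact: stX| | |exact: stY].
    by apply: sep; [apply: subsetP xX | apply: subsetP yY].
  by rewrite e_sym; apply: sep; [apply: subsetP yX | apply: subsetP xY].
have -> : (A :|: B) :\: (X :|: Y) = (A :\: X) :|: (B :\: Y).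
  apply/setP => v; have /setP/(_ v) := disjoint_setI0 disj.
  have /implyP := subsetP sXA v; have /implyP := subsetP sYB v; rewrite !inE.
  by case: (v \in A) (v \in B) (v \in X) (v \in Y) => [] [] [] [].
apply: IHr wX wY.
  by apply: disjointWl (subsetDl A X) _; apply: disjointWr (subsetDl B Y) _.
by move=> x y /setDP[xA _] /setDP[yB _]; apply: sep.
Qed.

(** Painter colors [v] as soon as no neighbor takes the current color, which
    happens before its marks are used up. *)
Lemma win_add_vertex r A v f :
    v \notin A -> #|[set w in A | e v w]| < f v ->
  win e r A f -> win e r (v |: A) f.
Proof.
elim: r A f => [|r IHr] A f vA deg.
  move=> /win0P fA; apply/win0P => w /setU1P[->|/fA//].
  by rewrite -lt0n; apply: leq_ltn_trans deg.
move=> /winSP winA; apply/winSP => V legV.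
have [X [sX stX winX]] := winA V (legal_roundS (subsetUr [set v] A) legV).
have sXA := subset_trans sX (subsetIl A V).
have vX : v \notin X by apply: contra vA; apply: subsetP.
have sub : [set w in A :\: X | e v w] \subset [set w in A | e v w].
  by apply/subsetP => w; rewrite !inE => /andP[/andP[_ ->]].
have sXV : X \subset (v |: A) :&: V.
  by apply: subset_trans sX _; rewrite setSI // subsetUr.
have keep (g : T -> nat) : #|[set w in A :\: X | e v w]| < g v ->
    win e r (A :\: X) g -> win e r ((v |: A) :\: X) g.
  move=> degX gX; have -> : (v |: A) :\: X = v |: (A :\: X).
    by apply/setP => w; rewrite !inE; case: eqP => // ->; rewrite vX.
  by apply: IHr; rewrite // !inE negb_and vA orbT.
have [vV|vV] := boolP (v \in V); last first.
  exists X; split=> //; apply: keep => //.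
  rewrite /unmark (negbTE vV) subn0.
  by apply: leq_ltn_trans deg; apply: subset_leq_card.
have [/exists_inP[w wX evw]|/exists_inPn noX] := boolP [exists w in X, e v w].
  exists X; split=> //; apply: keep => //.
  rewrite /unmark vV ltn_subRL add1n; apply: leq_trans deg; rewrite ltnS.
  apply: proper_card; rewrite properE sub; apply/subsetPn; exists w.
    by rewrite inE evw (subsetP sXA).
  by rewrite !inE wX.
exists (v |: X); split.
- by rewrite subUset sub1set sXV !inE eqxx vV.
- apply/stableP => x y; move: stX => /stableP stX.
  case/setU1P=> [->|xX] /setU1P[->|yX]; [|exact: noX| |exact: stX].
    by rewrite e_irr.
  by rewrite e_sym noX.
suff -> : (v |: A) :\: (v |: X) = A :\: X by [].
apply/setP => w; rewrite !inE; case: eqP => // ->.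
by rewrite (negbTE vA) andbF.
Qed.

(** When two rounds remain, Lister has to mark in both of them every vertex
    with two marks left; if that excepts at most one vertex, Painter answers
    with a color class, the one which suits the exceptional vertex. *)
Lemma win_two_rounds A c f :
    coloring_on A c -> {in A, forall v, 0 < f v} ->
    {in A &, forall u v, f u != 2 -> f v != 2 -> u = v} ->
  win e 2 A f.
Proof.
move=> col f0 exc; apply/winSP => V /legal_roundP legV.
suff [b [marked left]] : exists b, {in A, forall v, c v = b -> v \in V} /\
    {in A, forall v, c v != b -> v \in V -> 1 < f v}.
  exists [set v in A | c v == b]; split.
  - apply/subsetP => v; rewrite !inE => /andP[vA /eqP cv].
    by rewrite vA (marked v vA cv).
  - apply/stableP => x y; rewrite !inE => /andP[xA /eqP cx] /andP[yA /eqP cy].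
    by apply/negP => /(col _ _ xA yA); rewrite cx cy eqxx.
  apply: win_stable => [|v].
    apply/stableP => x y; rewrite !inE.
    move=> /andP[cx xA] /andP[cy yA]; rewrite xA yA /= in cx cy.
    apply/negP => /(col _ _ xA yA).
    by move: cx cy; case: (c x); case: (c y); case: (b).
  rewrite !inE => /andP[cv vA]; rewrite vA /= in cv; rewrite /unmark.
  have := legV v vA; have := left v vA cv; case: (v \in V) => /=.
    by move=> /(_ isT); lia.
  by move=> _ _; rewrite subn0 f0.
have [/exists_inP[u uA fu]|/exists_inPn all2] := boolP [exists u in A, f u != 2].
  have two v : v \in A -> v != u -> f v = 2.
    by move=> vA vu; apply/eqP; apply: contraR vu => fv; apply/eqP; apply: exc.
  have inV v : v \in A -> v != u -> v \in V.
    by move=> vA vu; have := legV v vA; rewrite two //; case: (v \in V).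
  exists (if u \in V then c u else ~~ c u); split=> v vA cv.
  - have [vu|/inV] := eqVneq v u; last exact.
    by move: cv; rewrite vu; case: (u \in V) => //; case: (c u).
  - have [vu|/two -> //] := eqVneq v u; move: cv; rewrite vu.
    by case: (u \in V) => //; rewrite eqxx.
have two v : v \in A -> f v = 2 by move=> /all2/negPn/eqP.
exists true; split=> v vA _; last by rewrite two.
by have := legV v vA; rewrite two //; case: (v \in V).
Qed.

(** [A] induces a complete bipartite graph [K_{2,n}] in which [a] and [b] form
    the class of size 2. *)
Definition biclique2 A (a b : T) :=
  [/\ a \in A, b \in A, a != b
    & {in A &, forall x y, e x y = ((x \in [set a; b]) != (y \in [set a; b]))}].

Lemma biclique2C A a b : biclique2 A a b -> biclique2 A b a.
Proof.
case=> aA bA ab eA; split; rewrite 1?eq_sym // => x y xA yA.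
by rewrite eA // setUC.
Qed.

Lemma biclique2_coloring A a b :
  biclique2 A a b -> coloring_on A (fun x => x \in [set a; b]).
Proof. by case=> _ _ _ eA x y xA yA; rewrite eA. Qed.

Lemma biclique2_stable A a b : biclique2 A a b -> stable e (A :\: [set a; b]).
Proof.
case=> _ _ _ eA; apply/stableP => x y /setDP[xA xn] /setDP[yA yn].
by rewrite eA // (negbTE xn) (negbTE yn).
Qed.

Lemma biclique2_stable_ends A a b : biclique2 A a b -> stable e [set a; b].
Proof.
case=> aA bA _ eA; apply/stableP => x y xab yab; rewrite eA ?xab ?yab //.
  by case/set2P: xab => ->.
by case/set2P: yab => ->.
Qed.

Lemma biclique2D A a b X :
  biclique2 A a b -> X \subset A :\: [set a; b] -> biclique2 (A :\: X) a b.
Proof.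
case=> aA bA ab eA /subsetP sX; split=> //; first 1 last.
- rewrite inE bA andbT; apply/negP => /sX; by rewrite !inE eqxx orbT.
- by move=> x y /setDP[xA _] /setDP[yA _]; apply: eA.
- rewrite inE aA andbT; apply/negP => /sX; by rewrite !inE eqxx.
Qed.


(** Once both [a] and [b] are colored, no edges are left. *)
Lemma win_color_ends r A a b f V :
    biclique2 A a b -> {in A, forall v, f v = 2} -> a \in V -> b \in V ->
  exists X, [/\ X \subset A :&: V, stable e X & win e r (A :\: X) (unmark f V)].
Proof.
move=> KA f2 aV bV; have [aA bA _ _] := KA.
exists [set a; b]; split.
- by rewrite subUset !sub1set !inE aA bA aV bV.
- exact: biclique2_stable_ends KA.
- apply: win_stable; first exact: biclique2_stable KA.
  by move=> v /setDP[vA _]; rewrite /unmark f2 //; case: (v \in V).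
Qed.

(** Unless both [a] and [b] are marked in the first round, Painter colors all
    other marked vertices; then at most one uncolored vertex has lost a mark,
    so that two more rounds suffice. *)
Lemma biclique2_win3 A a b f :
  biclique2 A a b -> {in A, forall v, f v = 2} -> win e 3 A f.
Proof.
move=> KA f2; apply/winSP => V legV.
have [/andP[aV bV]|nabV] := boolP ((a \in V) && (b \in V)).
  exact: win_color_ends KA f2 aV bV.
set X := (A :\: [set a; b]) :&: V.
have endX v : v \in A :\: X -> v \in V -> v \in [set a; b].
  by rewrite /X !inE => /andP[+ vA] vV; rewrite vA vV !andbT negbK.
exists X; split.
- by rewrite /X setSI // subsetDl.
- apply/stableP => x y /setIP[xS _] /setIP[yS _].
  by move/stableP: (biclique2_stable KA); apply.
apply: win_two_rounds (coloring_onS (subsetDl A X) (biclique2_coloring KA)) _ _.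
- by move=> v /setDP[vA _]; rewrite /unmark f2 //; case: (v \in V).
move=> u v uAX vAX; rewrite /unmark.
have /setDP[uA _] := uAX; have /setDP[vA _] := vAX; rewrite !f2 //.
case uV: (u \in V) => //; case vV: (v \in V) => // _ _.
have := endX u uAX uV; have := endX v vAX vV.
case/set2P=> ?; case/set2P=> ?; subst => //; by rewrite uV vV in nabV.
Qed.

(** The bound on [A] allows at most three common neighbors of [a] and [b]: so
    at most one of them is marked, or at most one of them is unmarked.  In both
    cases the graph left by Painter has an orientation with fewer out-neighbors
    than marks. *)
Lemma biclique2_win_one_end r A a b f V :
    biclique2 A a b -> #|A| <= 5 -> {in A, forall v, f v = 2} ->
    a \in V -> b \notin V ->
  exists X, [/\ X \subset A :&: V, stable e X & win e r (A :\: X) (unmark f V)].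
Proof.
move=> KA leA5 f2 aV bV; have [aA bA ab eA] := KA.
set S := A :\: [set a; b].
have leS3 : #|S| <= 3.
  have : #|[set a; b]| = 2 by rewrite cards2 ab.
  have : [set a; b] \subset A by rewrite subUset !sub1set aA bA.
  by move=> /setIidPr sI c2; rewrite /S cardsD sI c2; lia.
have stS := biclique2_stable KA.
have out1 (D : rel T) v w : (forall u, D v u -> u = w) ->
    forall B, #|[set u in B | D v u]| <= 1.
  move=> uniqw B; rewrite -(cards1 w); apply: subset_leq_card.
  by apply/subsetP => u; rewrite !inE => /andP[_ /uniqw ->].
have [le1|gt1] := leqP #|S :&: V| 1.
  (* Only [a] is colored: the remaining star with center [b] is oriented
     towards [b], except for its marked leaf. *)
  exists [set a]; split.
  - by rewrite sub1set inE aA aV.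
  - by apply/stableP => x y /set1P-> /set1P->; rewrite e_irr.
  pose D x y := (y == b) && (x \notin V) && (x != b) || (x == b) && (y \in V).
  apply: (@win_orientation D (fun x => x == b)).
  - move=> x y _ _; rewrite /D => /orP[/andP[/andP[/eqP-> _]]|/andP[/eqP-> yV]].
      by rewrite eqxx; case: (x == b).
    by rewrite eqxx; apply: contraNneq bV => /esym/eqP<-.
  - move=> x y; rewrite !inE => /andP[xa xA] /andP[ya yA].
    rewrite eA // !inE (negbTE xa) (negbTE ya) /D /=.
    by case: (x == b); case: (y == b); case: (x \in V); case: (y \in V).
  - move=> v /setD1P[va vA]; rewrite /unmark f2 //.
    have [->|vb] := eqVneq v b.
      rewrite (negbTE bV) ltnS; apply: leq_trans le1.
      apply: subset_leq_card; apply/subsetP => w; rewrite /D !inE.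
      have : (w == b) ==> (w \notin V) by apply/implyP => /eqP->.
      rewrite eqxx andbF.
      by case: (w == a); case: (w == b); case: (w \in V) (w \in A) => [] [].
    case vV: (v \in V); last first.
      rewrite ltnS; apply: (out1 D v b) => u.
      by rewrite /D (negbTE vb) orbF => /andP[/andP[/eqP]].
    rewrite (_ : [set w in _ | _] = set0) ?cards0 //.
    by apply/setP => w; rewrite !inE /D vV (negbTE vb) /= !andbF.
(* All marked vertices besides [a] are colored: what remains is a path through
   [b] that ends in [a], or [a] and [b] alone. *)
exists (S :&: V); split.
- by rewrite setSI // subsetDl.
- apply/stableP => x y /setIP[xS _] /setIP[yS _].
  by move/stableP: stS; apply.
pose D x y := (x == b) && (y \notin [set a; b]) || (x \notin [set a; b]) && (y == a).
apply: (@win_orientation D (fun x => x \in [set a; b])).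
- move=> x y _ _; rewrite /D => /orP[/andP[/eqP-> /negbTE->]|/andP[/negbTE-> /eqP->]].
    by rewrite !inE eqxx orbT.
  by rewrite !inE eqxx.
- move=> x y /setDP[xA _] /setDP[yA _]; rewrite eA // /D !inE.
  by case: (x == a); case: (x == b); case: (y == a); case: (y == b).
- move=> v /setDP[vA vSV]; rewrite /unmark f2 //.
  have [->|va] := eqVneq v a.
    rewrite aV (_ : [set w in _ | _] = set0) ?cards0 //.
    by apply/setP => w; rewrite !inE /D !inE eqxx (negbTE ab) /= !andbF.
  have [->|vb] := eqVneq v b.
    rewrite (negbTE bV) ltnS.
    apply: (@leq_trans #|S :\: V|); last by rewrite cardsD; lia.
    apply: subset_leq_card; apply/subsetP => w; rewrite /D /S !inE eqxx orbT /=.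
    by case: (w == a); case: (w == b); case: (w \in V) (w \in A) => [] [].
  have vV : v \notin V by move: vSV; rewrite /S !inE vA (negbTE va) (negbTE vb).
  rewrite (negbTE vV) ltnS; apply: (out1 D v a) => u.
  by rewrite /D (negbTE vb) /= => /andP[_ /eqP].
Qed.

Lemma biclique2_win r A a b f :
    biclique2 A a b -> #|A| <= 5 -> {in A, forall v, f v = 2} -> win e r A f.
Proof.
elim: r A f => [|r IHr] A f KA leA5 f2.
  by apply/win0P => v /f2 ->.
apply/winSP => V legV.
have [aV|aV] := boolP (a \in V); have [bV|bV] := boolP (b \in V).
- exact: win_color_ends KA f2 aV bV.
- exact: biclique2_win_one_end KA leA5 f2 aV bV.
- exact: biclique2_win_one_end (biclique2C KA) leA5 f2 bV aV.
have KX := biclique2D KA (subsetIl (A :\: [set a; b]) V).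
exists ((A :\: [set a; b]) :&: V); split.
- by rewrite setSI // subsetDl.
- apply/stableP => x y /setIP[xS _] /setIP[yS _].
  by move/stableP: (biclique2_stable KA); apply.
apply: IHr KX _ _; first by apply: leq_trans leA5; rewrite subset_leq_card ?subsetDl.
move=> v /setDP[vA vX]; rewrite /unmark f2 //.
suff /negbTE-> : v \notin V by [].
apply: contra vX => vV; rewrite !inE vA vV !andbT negb_or.
by apply/andP; split; [apply: contraNneq aV | apply: contraNneq bV] => <-.
Qed.

(** Oriented cyclically, a cycle has one out-neighbor per vertex. *)
Lemma cycle_win r c (s : seq T) f :
    uniq s -> cycle e s -> coloring_on [set x in s] c ->
    {in s &, forall x y, e x y -> y = next s x \/ x = next s y} ->
    {in s, forall v, f v = 2} ->
  win e r [set x in s] f.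
Proof.
move=> us cs col chordless f2.
apply: (@win_orientation (fun x y => y == next s x) c) => [x y|x y|v]; rewrite ?inE.
- move=> xs ys /eqP yx; apply: col; rewrite ?inE // yx.
  exact: next_cycle cs xs.
- by move=> xs ys /(chordless _ _ xs ys) [->|->]; rewrite eqxx ?orbT.
- move=> vs; rewrite f2 // ltnS -(cards1 (next s v)) subset_leq_card //.
  by apply/subsetP => w; rewrite !inE => /andP[].
Qed.

End Painter.

(** * Lister's tools *)

Section Lister.
Variables (T : finType) (e : rel T).
Hypotheses (e_sym : symmetric e) (e_irr : irreflexive e).
Implicit Types (A B V W X Y : {set T}) (f : T -> nat) (c : T -> bool).

Lemma paintable_in2_bipartite : paintable_in e (fun=> 2) 2 -> bipartite e.
Proof.
case=> s wins; have [x0 _|T0] := pickP T; last first.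
  by exists (fun=> true) => x; have := T0 x.
have [||ind col] := wins [:: setT; setT] => //.
  split=> [|v]; last by rewrite /= in_setT.
  rewrite !inE !negb_or eq_sym -card_gt0 cardsT.
  by apply/andP; split; apply/card_gt0P; exists x0.
have [_ ind1] := ind 0 isT; have [_ ind2] := ind 1 isT; rewrite /= in ind1 ind2.
exists (fun x => x \in s [:: setT]) => x y exy.
have [xX|xX] := boolP (x \in _); have [yX|yX] := boolP (y \in _) => //.
  by have := ind1 x y xX yX; rewrite exy.
have later z : z \notin s [:: setT] -> z \in s [:: setT; setT].
  by move=> zX; have [[|[|//]] _ /=] := col z; rewrite ?(negbTE zX).
by have := ind2 x y (later x xX) (later y yX); rewrite exy.
Qed.

(** Connectedness of [V] is expressed by saying that a function which is constant
    along the edges in [V] is constant on [V].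

    Lister first marks [V].  As [V] is connected and Painter's first color
    class [X] is independent, either two adjacent vertices of [V] stay
    uncolored, or [X] is a color class of [V].  In the latter case the
    neighbors in [V] of [w1] or those of [w2] stay uncolored.  Now adjacent
    uncolored vertices lose if they are both marked in the second round, and
    uncolored vertices with a common unmarked neighbor lose if they are marked
    in different rounds, since that neighbor is marked in both. *)
Lemma lister_wins_three_rounds c V w1 w2 u1 v1 u2 v2 :
    (forall x y, e x y -> c x != c y) ->
    (forall g : T -> bool, {in V &, forall x y, e x y -> g x = g y} ->
       {in V &, forall x y, g x = g y}) ->
    c w1 != c w2 -> w1 \notin V -> w2 \notin V ->
    [/\ u1 \in V, v1 \in V, u1 != v1, e w1 u1 & e w1 v1] ->
    [/\ u2 \in V, v2 \in V, u2 != v2, e w2 u2 & e w2 v2] ->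
  ~ paintable_in e (fun=> 2) 3.
Proof.
move=> col conn cw w1V w2V nb1 nb2 [s wins].
have play V2 V3 : V2 != set0 -> V3 != set0 ->
    (forall v, (v \in V) + (v \in V2) + (v \in V3) = 2) ->
  painter_wins_play e s [:: V; V2; V3].
  move=> V20 V30 two; apply: wins => //; split=> [|v].
    rewrite !inE !negb_or ![set0 == _]eq_sym V20 V30 !andbT.
    by apply/set0Pn; exists u1; case: nb1.
  by rewrite /= addn0 addnA.
pose X := s [:: V].
have not0 A (x : T) : x \in A -> A != set0 by move=> xA; apply/set0Pn; exists x.
have [sXV stX] : X \subset V /\ independent e X.
  case: (play setT (~: V)); first 1 last.
  - by apply: (not0 _ w1); rewrite inE.
  - by move=> v; rewrite !inE; case: (v \in V).
  - by move=> /(_ 0 isT) + _.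
  - by apply: (not0 _ w1); rewrite inE.
have uncolored V2 V3 v : V2 != set0 -> V3 != set0 ->
    (forall v, (v \in V) + (v \in V2) + (v \in V3) = 2) -> v \notin X ->
  v \in s [:: V; V2] \/ v \in s [:: V; V2; V3].
  move=> V20 V30 two vX; have [_ /(_ v)[[|[|[|//]]] _ /=]] := play V2 V3 V20 V30 two.
  - by rewrite -/X (negbTE vX).
  - by left.
  - by right.
have adjacent u v : u \in V -> v \in V -> u \notin X -> v \notin X -> ~~ e u v.
  move=> uV vV uX vX; apply/negP => euv.
  pose V2 := ~: V :|: [set u; v]; pose V3 := ~: [set u; v].
  have V20 : V2 != set0 by apply: (not0 _ u); rewrite !inE eqxx orbT.
  have V30 : V3 != set0.
    apply: (not0 _ w1); rewrite !inE negb_or.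
    by apply/andP; split; apply: contraNneq w1V => ->.
  have two x : (x \in V) + (x \in V2) + (x \in V3) = 2.
    rewrite !inE; have [->|xu] := eqVneq x u; first by rewrite uV.
    by have [->|xv] := eqVneq x v; rewrite ?vV //=; case: (x \in V).
  have [ind _] := play V2 V3 V20 V30 two.
  have [_ ind2] := ind 1 isT; have [/subsetP sub3 _] := ind 2 isT.
  have in2 x : x \in [set u; v] -> x \notin X -> x \in s [:: V; V2].
    move=> xuv xX; have [//|/sub3] := uncolored V2 V3 x V20 V30 two xX.
    by rewrite /= inE xuv.
  have := ind2 u v; rewrite /= !in2 ?inE ?eqxx ?orbT // euv.
  by move=> /(_ isT isT).
have common w u v : w \notin V -> [/\ u \in V, v \in V, u != v, e w u & e w v] ->
    u \in X \/ v \in X.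
  move=> wV [uV vV uv ewu ewv].
  have [|uX] := boolP (u \in X); first by left.
  have [|vX] := boolP (v \in X); [by right | exfalso].
  pose V2 := u |: ~: V; pose V3 := ~: [set u].
  have V20 : V2 != set0 by apply: (not0 _ u); rewrite !inE eqxx.
  have V30 : V3 != set0 by apply: (not0 _ v); rewrite !inE eq_sym.
  have two x : (x \in V) + (x \in V2) + (x \in V3) = 2.
    rewrite !inE; have [->|xu] := eqVneq x u; first by rewrite uV.
    by case: (x \in V).
  have [ind _] := play V2 V3 V20 V30 two.
  have [/subsetP sub2 ind2] := ind 1 isT; have [/subsetP sub3 ind3] := ind 2 isT.
  have u2' : u \in s [:: V; V2].
    have [//|/sub3] := uncolored V2 V3 u V20 V30 two uX.
    by rewrite /= !inE eqxx.
  have v3' : v \in s [:: V; V2; V3].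
    have [/sub2|//] := uncolored V2 V3 v V20 V30 two vX.
    by rewrite /= !inE vV eq_sym (negbTE uv).
  have wX : w \notin X by apply: contra wV; apply: subsetP.
  have [w2'|w3'] := uncolored V2 V3 w V20 V30 two wX.
    by have := ind2 w u w2' u2'; rewrite ewu.
  by have := ind3 w v w3' v3'; rewrite ewv.
have class x y : x \in V -> y \in V -> (x \in X) (+) c x = (y \in X) (+) c y.
  apply: (conn (fun x => (x \in X) (+) c x)) => x' y' xV yV exy.
  have := stX x' y'; have := adjacent x' y' xV yV; rewrite exy.
  have := col _ _ exy; case: (c x'); case: (c y') => // _;
    case: (x' \in X); case: (y' \in X) => // H1 H2;
    by [have := H1 isT isT | have := H2 isT isT].
have inX w u v : w \notin V -> [/\ u \in V, v \in V, u != v, e w u & e w v] ->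
    exists2 x, x \in V & (x \in X) (+) c x = c w (+) false.
  move=> wV nb; case: (nb) => uV vV uv /col cu /col cv.
  have [uX|vX] := common w u v wV nb.
    by exists u; rewrite // uX; case: (c u) (c w) cu => [] [].
  by exists v; rewrite // vX; case: (c v) (c w) cv => [] [].
have [x1 x1V h1] := inX w1 u1 v1 w1V nb1.
have [x2 x2V h2] := inX w2 u2 v2 w2V nb2.
have := class x1 x2 x1V x2V; rewrite h1 h2 !addbF => cww.
by rewrite cww eqxx in cw.
Qed.

(** The list assignment that shows that [K_{2,4}] is not 2-choosable: the end
    [a] has the colors 1 and 2, the end [b] has 3 and 4, and the four common
    neighbors have one color of each end, in the four possible ways. *)
Lemma lister_wins_four_rounds (a b x13 x14 x23 x24 : T) :
    a != b -> uniq [:: x13; x14; x23; x24] ->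
    {in [:: x13; x14; x23; x24], forall x, e x a && e x b} ->
  ~ paintable_in e (fun=> 2) 4.
Proof.
move=> ab ux adj [s wins].
pose Q := [:: a; b; x13; x14; x23; x24].
have xa x : x \in [:: x13; x14; x23; x24] -> (x != a) && (x != b).
  move=> xs; have /andP[exa exb] := adj x xs.
  by apply/andP; split; [apply: contraTneq exa | apply: contraTneq exb] => ->; rewrite e_irr.
have uQ : uniq Q.
  rewrite /Q cons_uniq inE negb_or ab cons_uniq ux andbT /=.
  by apply/andP; split; apply/negP => /xa; rewrite eqxx ?andbF.
(* The vertices outside [Q], of index 6, have the colors 1 and 2. *)
pose marked (l : seq nat) := [set x | index x Q \in l].
pose Vs := [:: marked [:: 0; 2; 3; 6]; marked [:: 0; 4; 5; 6];
               marked [:: 1; 2; 4]; marked [:: 1; 3; 5]].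
have two v : count (fun V : {set T} => v \in V) Vs = 2.
  rewrite /= !in_set; have : index v Q <= 6 by apply: (index_size v Q).
  by case: (index v Q) => [|[|[|[|[|[|[|]]]]]]].
have indexQ i : i < 6 -> index (nth a Q i) Q = i by move=> lti; apply: index_uniq.
have [||ind col] := wins Vs => //.
  split=> //; rewrite !inE !negb_or ![set0 == _]eq_sym.
  apply/and4P; split; apply/set0Pn;
    by [exists (nth a Q 0); rewrite inE indexQ | exists (nth a Q 1); rewrite inE indexQ].
have colored i : i < 6 -> exists k,
    [/\ k < 4, nth a Q i \in s (take k.+1 Vs)
      & i \in nth [::] [:: [:: 0; 2; 3; 6]; [:: 0; 4; 5; 6]; [:: 1; 2; 4]; [:: 1; 3; 5]] k].
  move=> lti; have [k ltk xk] := col (nth a Q i); exists k; split=> //.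
  have [/subsetP/(_ _ xk) + _] := ind k ltk.
  by case: k ltk {xk} => [|[|[|[|//]]]] _ /=; rewrite in_set indexQ.
have conflict i j k : k < 4 -> 1 < i < 6 -> j < 2 ->
    nth a Q i \in s (take k.+1 Vs) -> nth a Q j \in s (take k.+1 Vs) -> False.
  move=> ltk lti ltj xi xj; have [_ /(_ _ _ xi xj)] := ind k ltk.
  case: i lti {xi} => [|[|i]] //= lti.
  have /andP[ea eb] := adj _ (mem_nth a (lti : i < size [:: x13; x14; x23; x24])).
  by case: j ltj {xj} => [|[|//]] _ /=; rewrite ?ea ?eb.
have [ka [lta ina la]] := colored 0 isT; have [kb [ltb inb lb]] := colored 1 isT.
have clash i : 1 < i < 6 -> (forall k, k < 4 ->
    i \in nth [::] [:: [:: 0; 2; 3; 6]; [:: 0; 4; 5; 6]; [:: 1; 2; 4]; [:: 1; 3; 5]] k ->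
    k = ka \/ k = kb) -> False.
  move=> lti two_colors; have [|k [ltk ink /two_colors[//| |]]] := colored i.
  - by case/andP: lti.
  - by move=> kk; subst k; apply: conflict ink ina.
  - by move=> kk; subst k; apply: conflict ink inb.
case: ka lta la ina clash => [|[|[|[|//]]]] // _ _ _;
  case: kb ltb lb inb => [|[|[|[|//]]]] // _ _ _ clash;
  [apply: (clash 2) | apply: (clash 3) | apply: (clash 4) | apply: (clash 5)] => //;
  by move=> [|[|[|[|//]]]] //; auto.
Qed.

End Lister.

(** * Dumbbells *)

Section Dumbbells.
Variables (T : finType) (e : rel T).
Hypotheses (e_sym : symmetric e) (e_irr : irreflexive e).

(** The vertices of a dumbbell in the order of their numbering, as a sequence
    with arbitrary values beyond the last vertex. *)
Definition dumbbell_at m k n (v : nat -> T) :=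
  [/\ forall i j, i < m + k + n - 2 -> j < m + k + n - 2 -> v i = v j -> i = j,
      forall i, i.+1 < m + k + n - 2 -> e (v i) (v i.+1),
      e (v 0) (v m.-1)
    & e (v (m + k - 2)) (v (m + k + n - 3))].

Lemma dumbbellP m k n : 3 <= m -> 1 <= k -> 3 <= n ->
  contains_subgraph e (dumbbell m k n) <-> exists v, dumbbell_at m k n v.
Proof.
move=> m3 k1 n3; split=> [[h inj_h hom_h] | [v [inj_v arc_v loop1 loop2]]]; last first.
  exists (fun i : 'I__ => v i) => [i j /inj_v vij|i j].
    by apply/val_inj/vij.
  have ijN := (ltn_ord i, ltn_ord j).
  wlog H : i j ijN / [|| i.+1 == j, (i == 0 :> nat) && (j == m.-1 :> nat)
      | (i == m + k - 2 :> nat) && (j == m + k + n - 3 :> nat)].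
    move=> sym /orP[] arc; [|rewrite e_sym]; apply: sym => //; last by rewrite /dumbbell arc.
    by rewrite /dumbbell arc.
  move=> _; case/or3P: H => [/eqP ij|/andP[/eqP-> /eqP->]|/andP[/eqP-> /eqP->]] //.
  by rewrite -ij; apply: arc_v; rewrite ij.
have N0 : 0 < m + k + n - 2 by lia.
pose v i := h (odflt (Ordinal N0) (insub i)).
have vE i (lti : i < m + k + n - 2) : v i = h (Ordinal lti) by rewrite /v insubT.
exists v; split.
- by move=> i j lti ltj; rewrite !vE => /inj_h[].
- move=> i lti; rewrite (vE i (ltnW lti)) (vE i.+1 lti); apply: hom_h.
  by rewrite /dumbbell /= eqxx.
- have ltm : m.-1 < m + k + n - 2 by lia.
  by rewrite (vE _ N0) (vE _ ltm); apply: hom_h; rewrite /dumbbell /= !eqxx orbT.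
- have lt1 : m + k - 2 < m + k + n - 2 by lia.
  have lt2 : m + k + n - 3 < m + k + n - 2 by lia.
  by rewrite (vE _ lt1) (vE _ lt2); apply: hom_h; rewrite /dumbbell /= !eqxx !orbT.
Qed.

(** Removing from each cycle a vertex of degree 2 leaves the dumbbell
    connected.  In the second cycle one of the two vertices that come last has
    the other color than the vertex removed from the first cycle. *)
Lemma dumbbell_not_paintable_in3 (c : T -> bool) m k n :
    3 <= m -> 1 <= k -> 3 <= n -> (forall x y, e x y -> c x != c y) ->
    contains_subgraph e (dumbbell m k n) ->
  ~ paintable_in e (fun=> 2) 3.
Proof.
move=> m3 k1 n3 col /(dumbbellP m3 k1 n3)[v].
set N := m + k + n - 2; case=> inj_v arc_v loop1 loop2.
have [j [cj ltjN jb]] : exists j, [/\ c (v 0) != c (v j), j < N & N - 2 <= j].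
  have [c2|c2] := eqVneq (c (v 0)) (c (v (N - 2))); last first.
    by exists (N - 2); split=> //; rewrite /N; lia.
  exists (N - 1); split; rewrite ?c2 //; try by rewrite /N; lia.
  have -> : N - 1 = (N - 2).+1 by rewrite /N; lia.
  by apply/col/arc_v; rewrite /N; lia.
pose V := [set x | [exists i : 'I_N, [&& i != 0 :> nat, i != j :> nat & x == v i]]].
have inV i : i < N -> (v i \in V) = (i != 0) && (i != j).
  move=> ltiN; rewrite inE; apply/existsP/andP => [[i'] | [i0 ij]].
    by case/and3P=> i0 ij /eqP/inj_v->.
  by exists (Ordinal ltiN); rewrite /= i0 ij eqxx.
have VP x : x \in V -> exists2 i, x = v i & [/\ i < N, i != 0 & i != j].
  by rewrite inE => /existsP[i /and3P[i0 ij /eqP->]]; exists i.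
have neighbors i1 i2 w : i1 < N -> i2 < N -> i1 != i2 -> 0 < i1 -> 0 < i2 ->
    i1 != j -> i2 != j -> e w (v i1) -> e w (v i2) ->
    [/\ v i1 \in V, v i2 \in V, v i1 != v i2, e w (v i1) & e w (v i2)].
  move=> lt1 lt2 i12 i1p i2p i1j i2j e1 e2.
  rewrite !inV // -!lt0n i1p i2p i1j i2j; split=> //.
  by apply: contra_neq i12; apply: inj_v.
apply: (@lister_wins_three_rounds _ _ c V (v 0) (v j) (v 1) (v m.-1)
   (v j.-1) (v (if j == N - 1 then m + k - 2 else N - 1))) => //.
- move=> g hom_g.
  have left i : 0 < i -> i < j -> g (v i) = g (v 1).
    elim: i => // -[|i] IH // _ lti; rewrite -IH //; last exact: ltnW.
    apply/esym/hom_g; rewrite ?inV //; try by rewrite /N in ltjN *; lia.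
    by apply: arc_v; lia.
  suff toV1 x : x \in V -> g x = g (v 1) by move=> x y /toV1-> /toV1->.
  case/VP=> i -> [lti i0 ij]; have [ltij|leji] := ltnP i j.
    by apply: left => //; lia.
  have -> : i = m + k + n - 3 by rewrite /N in lti jb; lia.
  rewrite -(left (m + k - 2)); first 1 last.
  - by rewrite /N in lti; lia.
  - by rewrite /N in lti jb; lia.
  apply/esym/hom_g => //; last first.
    by rewrite -(_ : i = m + k + n - 3) ?inV; rewrite /N in lti jb *; lia.
  by rewrite inV; rewrite /N in lti jb ltjN *; lia.
- by rewrite inV ?eqxx //; lia.
- by rewrite inV ?eqxx ?andbF.
- apply: neighbors => //; rewrite /N in ltjN jb *; try lia.
  by apply: arc_v; rewrite /N; lia.
- apply: neighbors; rewrite ?[e (v j) (v j.-1)]e_sym; try by rewrite /N in ltjN jb *; lia.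
  + by case: ifP => H; rewrite /N in H ltjN jb *; lia.
  + by case: ifP => H; rewrite /N in H ltjN jb *; lia.
  + by case: ifP => H; rewrite /N in H ltjN jb *; lia.
  + by case: ifP => H; rewrite /N in H ltjN jb *; lia.
  + have {2}-> : j = j.-1.+1 by rewrite /N in jb; lia.
    by apply: arc_v; rewrite /N in jb ltjN *; lia.
  + case: ifP => [/eqP->|H].
      by rewrite e_sym (_ : N - 1 = m + k + n - 3) //; rewrite /N; lia.
    rewrite (_ : N - 1 = j.+1); last by rewrite /N in H ltjN jb *; lia.
    by apply: arc_v; rewrite /N in H ltjN jb *; lia.
Qed.

End Dumbbells.

(** * Theta graphs *)

Section ThetaVertices.
Variable ps : seq nat.
Implicit Types i j : 'I_(size ps).
Notation p i := (nth 0 ps i).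

Lemma theta_pt_inner i k (ltk : k < (p i).-1) :
  theta_pt i k.+1
  = inr (Tagged (fun i : 'I_(size ps) => 'I_(p i).-1) (Ordinal ltk)).
Proof. by rewrite /theta_pt insubT. Qed.

Lemma theta_pt_end i : 0 < p i -> theta_pt i (p i) = inl true.
Proof.
move=> p0; rewrite -(prednK p0) /theta_pt.
by case: insubP => // u; rewrite -{2}(prednK p0) ltnn.
Qed.

Lemma theta_pt_inj i j k l : 0 < k < p i -> l <= p j ->
  theta_pt i k = theta_pt j l -> i = j /\ k = l.
Proof.
case: k => // k ltk; have ltk' : k < (p i).-1 by lia.
rewrite (theta_pt_inner ltk'); case: l => // l lel.
have [ltl|gel] := ltnP l (p j).-1; last first.
  have -> : l.+1 = p j by lia.
  by rewrite theta_pt_end //; lia.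
rewrite (theta_pt_inner ltl) => eq_inr; have E := inr_inj eq_inr.
have ij : i = j := congr1 tag E; subst j.
by move/eqP: E; rewrite eq_Tagged => /eqP[->].
Qed.

Lemma theta_pt_inj_path i k l : k <= p i -> l <= p i ->
  theta_pt i k = theta_pt i l -> k = l.
Proof.
move=> lek lel E; have [/andP[k0 ltk]|nk] := boolP (0 < k < p i).
  have [|_ ->] := theta_pt_inj (i := i) (j := i) (k := k) (l := l) _ lel E;
  by rewrite ?k0.
have [/andP[l0 ltl]|nl] := boolP (0 < l < p i).
  have [|_ ->] := theta_pt_inj (i := i) (j := i) (k := l) (l := k) _ lek (esym E);
  by rewrite ?l0.
have [p0|p0] := posnP (p i); first by lia.
have [k0|k0] := posnP k; have [l0|l0] := posnP l; try lia; exfalso.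
  by move: E; rewrite k0 (_ : l = p i) ?theta_pt_end //; lia.
by move: E; rewrite l0 (_ : k = p i) ?theta_pt_end //; lia.
Qed.

Variant theta_vertex_spec : theta_vertex ps -> Prop :=
  | ThetaEnd b : theta_vertex_spec (inl b)
  | ThetaInner i k of 0 < k < p i : theta_vertex_spec (theta_pt i k).

Lemma theta_vertexP x : theta_vertex_spec x.
Proof.
case: x => [b|[i [k ltk]]]; first by constructor.
rewrite -(theta_pt_inner ltk); constructor; lia.
Qed.

Lemma theta_arc i k : k < p i -> theta ps (theta_pt i k) (theta_pt i k.+1).
Proof.
move=> ltk; apply/existsP; exists i; apply/existsP; exists (Ordinal ltk).
by rewrite !eqxx.
Qed.

End ThetaVertices.

Section Thetas.
Variables (T : finType) (e : rel T).
Hypotheses (e_sym : symmetric e) (e_irr : irreflexive e).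

(** The vertices removed from two of the three paths are chosen of different
    colors, one next to the common beginning of the paths, the other at
    distance 1 or 2 from it; the third path keeps the rest connected. *)
Lemma theta_not_paintable_in3_of_lengths (c : T -> bool) (ps : seq nat)
      (i j l : 'I_(size ps)) :
    (forall x y, e x y -> c x != c y) ->
    i != j -> i != l -> j != l -> (forall q, [|| q == i, q == j | q == l]) ->
    2 <= nth 0 ps i -> 3 <= nth 0 ps j -> 1 <= nth 0 ps l ->
    contains_subgraph e (theta ps) ->
  ~ paintable_in e (fun=> 2) 3.
Proof.
move=> col ij il jl all_ijl pi2 pj3 pl1 [h inj_h hom_h].
have [ji li lj] : [/\ (j == i) = false, (l == i) = false & (l == j) = false].
  by rewrite ![_ == i]eq_sym [l == j]eq_sym !(negbTE ij, negbTE il, negbTE jl).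
pose v (q : 'I_(size ps)) k := h (theta_pt q k).
have arc (q : 'I_(size ps)) k : k < nth 0 ps q -> e (v q k) (v q k.+1).
  by move=> ltk; apply/hom_h/theta_arc.
(* The removed vertices are [v i 1] and [v j t]. *)
have [t [ct t0 t2]] : exists t, [/\ c (v i 1) != c (v j t), 0 < t & t <= 2].
  have [c1|] := eqVneq (c (v i 1)) (c (v j 1)); last by exists 1.
  by exists 2; split=> //; rewrite c1; apply/col/arc/ltnW.
pose V := [set h x | x : theta_vertex ps & (x != theta_pt i 1) && (x != theta_pt j t)].
have inV x : (h x \in V) = (x != theta_pt i 1) && (x != theta_pt j t).
  by rewrite mem_imset // inE.
have injv (q : 'I_(size ps)) k k' :
    k <= nth 0 ps q -> k' <= nth 0 ps q -> k != k' -> v q k != v q k'.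
  move=> lek lek'; apply: contra_neq => /inj_h; exact: theta_pt_inj_path.
have vV (q : 'I_(size ps)) k : k <= nth 0 ps q ->
    (q == i) && (k == 1) || (q == j) && (k == t) = false ->
    v q k \in V.
  move=> lek /negbT; rewrite inV negb_or !negb_and => /andP[qi qj].
  apply/andP; split; apply/negP => /eqP E.
    have [||qq kk] := theta_pt_inj (i := i) (j := q) _ _ (esym E); rewrite ?lek //.
    by move: qi; rewrite -qq -kk !eqxx.
  have [||qq kk] := theta_pt_inj (i := j) (j := q) _ _ (esym E); rewrite ?lek //.
    by rewrite t0; apply: leq_ltn_trans pj3.
  by move: qj; rewrite -qq -kk !eqxx.
have ltj : t < nth 0 ps j by apply: leq_ltn_trans pj3.
apply: (@lister_wins_three_rounds _ _ c V (v i 1) (v j t) (v i 0) (v i 2)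
   (v j t.-1) (v j t.+1)) => //.
- move=> g hom_g.
  have segment (q : 'I_(size ps)) k k' : k <= k' -> k' <= nth 0 ps q ->
      (forall k'', k <= k'' <= k' ->
         (q == i) && (k'' == 1) || (q == j) && (k'' == t) = false) ->
    g (v q k) = g (v q k').
    move=> lekk'; elim: k' lekk' => [|k' IH]; first by rewrite leqn0 => /eqP->.
    rewrite leq_eqVlt => /orP[/eqP-> //|ltkk'] ltk' free.
    rewrite IH //; try exact: ltnW.
      apply: hom_g; try exact: arc; apply: vV;
        rewrite ?free ?leqnn ?ltkk' // ?andbT; clear -ltk' ltkk'; lia.
    by move=> k'' /andP[le1 le2]; apply: free; rewrite le1 leqW.
  have begin (q : 'I_(size ps)) : v q 0 = h (inl false) by [].
  have ends (q : 'I_(size ps)) : 0 < nth 0 ps q -> v q (nth 0 ps q) = h (inl true).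
    by move=> p0; rewrite /v theta_pt_end.
  have to_begin x : x \in V -> g x = g (h (inl false)).
    case/imsetP=> y; rewrite inE => /andP[yi yj] ->.
    have end_l : g (h (inl true)) = g (h (inl false)).
      rewrite -(begin l) -(ends l) //; apply/esym/segment => // k _.
      by rewrite li lj.
    case: (theta_vertexP y) yi yj => [[]//|q k /andP[k0 ltk]] yi yj.
    case/or3P: (all_ijl q) => /eqP qE; subst q.
    - have k1 : 1 < k by rewrite ltn_neqAle k0 eq_sym (contra_neq _ yi) // => ->.
      rewrite -end_l -(ends i) 1?ltnW //; apply: segment => // [|k' /andP[lek' _]].
        exact: ltnW.
      by rewrite eqxx (negbTE ij) orbF; clear -k1 lek'; lia.
    - have kt : k != t by apply: contra_neq yj => ->.
      have [lekt|gtkt] := ltnP k t.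
        rewrite -(begin j); apply/esym/segment => // [|k' /andP[_ lek']].
          exact: ltnW.
        by rewrite eqxx ji /=; clear -lekt lek'; lia.
      rewrite -end_l -(ends j) 1?ltnW //; last exact: ltnW.
      apply: segment => // [|k' /andP[lek' _]]; first exact: ltnW.
      by rewrite eqxx ji /=; clear -gtkt kt lek'; lia.
    - rewrite -(begin l); apply/esym/segment => // [|k' _]; first exact: ltnW.
      by rewrite li lj.
  by move=> x y /to_begin-> /to_begin->.
- by rewrite inV eqxx.
- by rewrite inV eqxx andbF.
- split; try by [apply: vV; rewrite ?eqxx ?(negbTE ij) ?andbF | apply: injv].
    by rewrite e_sym; apply: arc; apply: ltnW.
  exact: arc.
- split; try by [ apply: vV; rewrite ?eqxx ?ji //=; clear -t0 ltj; lia
                | apply: injv; clear -t0 ltj; lia ].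
    rewrite e_sym; have {2}-> : t = t.-1.+1 by rewrite prednK.
    by apply: arc; clear -t0 ltj; lia.
  exact: arc.
Qed.



Lemma theta_parity (c : T -> bool) (ps : seq nat) (i j : 'I_(size ps)) :
    (forall x y, e x y -> c x != c y) -> contains_subgraph e (theta ps) ->
    0 < nth 0 ps i -> 0 < nth 0 ps j ->
  odd (nth 0 ps i) = odd (nth 0 ps j).
Proof.
move=> col [h _ hom_h] pi0 pj0.
have walk (q : 'I_(size ps)) k : k <= nth 0 ps q ->
    c (h (theta_pt q k)) = c (h (inl false)) (+) odd k.
  elim: k => [|k IH] ltk; first by rewrite addbF.
  have := col _ _ (hom_h _ _ (theta_arc ltk)); rewrite IH; last exact: ltnW.
  by rewrite /=; case: (c _) (odd k) (c _) => [] [] [].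
have := walk i _ (leqnn _); have := walk j _ (leqnn _).
by rewrite !theta_pt_end // => -> /addbI ->.
Qed.

Lemma theta_not_paintable_in3 (c : T -> bool) p q r :
    (forall x y, e x y -> c x != c y) ->
    theta_simple [:: p; q; r] -> [:: p; q; r] != [:: 2; 2; 2] ->
    contains_subgraph e (theta [:: p; q; r]) ->
  ~ paintable_in e (fun=> 2) 3.
Proof.
move=> col simple ne222 sub.
pose o0 : 'I_3 := Ordinal (isT : 0 < 3); pose o1 : 'I_3 := Ordinal (isT : 1 < 3).
pose o2 : 'I_3 := Ordinal (isT : 2 < 3).
move: simple; rewrite /theta_simple /= => /andP[/and4P[p1 q1 r1 _] few1].
have pq := theta_parity (ps := [:: p; q; r]) (i := o0) (j := o1) col sub p1 q1.
have pr := theta_parity (ps := [:: p; q; r]) (i := o0) (j := o2) col sub p1 r1.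
rewrite /= in pq pr.
have [i [j [l [[ij il jl all_ijl] [pi2 pj3 pl1]]]]] : exists i j l : 'I_3,
    [/\ i != j, i != l, j != l & forall q, [|| q == i, q == j | q == l]] /\
    [/\ 2 <= nth 0 [:: p; q; r] i, 3 <= nth 0 [:: p; q; r] j
      & 1 <= nth 0 [:: p; q; r] l].
  have all3 (i j l : 'I_3) : perm_eq [:: val i; val j; val l] [:: 0; 1; 2] ->
      [/\ i != j, i != l, j != l & forall q, [|| q == i, q == j | q == l]].
    move=> perm; have := perm_uniq perm.
    rewrite /= !inE negb_or => /andP[/andP[ij il] /andP[jl _]].
    split=> // x; have := perm_mem perm (val x); rewrite !inE => ->.
    by case: x => [[|[|[|]]]].
  have not222 : ~~ [&& p == 2, q == 2 & r == 2].
    by apply: contra ne222 => /and3P[/eqP-> /eqP-> /eqP->].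
  have : [|| (2 <= p) && (3 <= q), (2 <= p) && (3 <= r), (2 <= q) && (3 <= p),
             (2 <= q) && (3 <= r), (2 <= r) && (3 <= p) | (2 <= r) && (3 <= q)].
    move: p1 q1 r1 few1 pq pr not222; clear.
    by case: p q r => [|[|[|p]]] [|[|[|q]]] [|[|[|r]]].
  case/orP=> [/andP[? ?]|]; first by exists o0, o1, o2; split; [apply: all3|split].
  case/orP=> [/andP[? ?]|]; first by exists o0, o2, o1; split; [apply: all3|split].
  case/orP=> [/andP[? ?]|]; first by exists o1, o0, o2; split; [apply: all3|split].
  case/orP=> [/andP[? ?]|]; first by exists o1, o2, o0; split; [apply: all3|split].
  case/orP=> [/andP[? ?]|/andP[? ?]]; first by exists o2, o0, o1; split; [apply: all3|split].
  by exists o2, o1, o0; split; [apply: all3|split].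
exact: (@theta_not_paintable_in3_of_lengths c [:: p; q; r] i j l).
Qed.

End Thetas.

(** * The families of subgraphs *)

Lemma contains_iso (T U W : finType) (e : rel T) (d : rel U) (d' : rel W) :
  contains_subgraph e d -> isomorphic d d' -> contains_subgraph e d'.
Proof.
move=> [h inj_h hom_h] [g [g' gK g'K] iso_g]; exists (h \o g').
  by apply: inj_comp => //; apply: can_inj g'K.
by move=> x y dxy; apply: hom_h; rewrite -iso_g !g'K.
Qed.

Lemma isomorphic_refl (T : finType) (e : rel T) : isomorphic e e.
Proof. by exists id => //; exists id. Qed.

Lemma isomorphic_card (T U : finType) (e : rel T) (d : rel U) :
  isomorphic e d -> #|T| = #|U|.
Proof. by case=> h bij_h _; apply: bij_eq_card bij_h. Qed.

Lemma card_theta_vertex3 p q r :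
  #|{: theta_vertex [:: p; q; r]}| = 2 + (p.-1 + q.-1 + r.-1).
Proof.
rewrite card_sum card_bool card_tagged sumnE big_map big_enum /=.
by rewrite !big_ord_recl big_ord0 !card_ord /= addn0 -(addnA p.-1).
Qed.

Section Families.
Variables (T : finType) (e : rel T).
Hypotheses (e_sym : symmetric e) (e_irr : irreflexive e).

Lemma F234_not_paintable_in3 :
  bipartite e -> contains_F234 e -> ~ paintable_in e (fun=> 2) 3.
Proof.
case=> c col [U [d [sub_d]]].
case=> [[m [k [n [m3 k1 n3 iso]]]]|[p [q [r [simple iso new]]]]|[n [n1 iso new]]].
- exact: (dumbbell_not_paintable_in3 e_sym m3 k1 n3 col (contains_iso sub_d iso)).
- have ne222 : [:: p; q; r] != [:: 2; 2; 2].
    apply/eqP => -[pE qE rE]; subst; exact: (new 1 isT iso).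
  exact: (theta_not_paintable_in3 e_sym col simple ne222 (contains_iso sub_d iso)).
- have simple : theta_simple [:: 2; 2; n.*2] by rewrite /theta_simple /=; lia.
  have ne222 : [:: 2; 2; n.*2] != [:: 2; 2; 2].
    apply/eqP => -[nE]; have nn : n = 1 by lia.
    by subst n; exact: new iso.
  exact: (theta_not_paintable_in3 e_sym col simple ne222 (contains_iso sub_d iso)).
Qed.

Lemma dumbbell_contains_F234 m k n : 3 <= m -> 1 <= k -> 3 <= n ->
  contains_subgraph e (dumbbell m k n) -> contains_F234 e.
Proof.
move=> m3 k1 n3 sub; exists _, (dumbbell m k n); split=> //; constructor 1.
by exists m, k, n; split=> //; apply: isomorphic_refl.
Qed.

(** The families [in_F3] and [in_F4] together consist of all thetas except
    [theta_{2,2,2}], the only bipartite one with five vertices. *)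
Lemma theta_contains_F234 p q r : theta_simple [:: p; q; r] ->
  p + q + r != 6 -> contains_subgraph e (theta [:: p; q; r]) -> contains_F234 e.
Proof.
move=> simple ne6 sub; exists _, (theta [:: p; q; r]); split=> //.
have [[n [n1 iso]]|none] := classic (exists n, 1 <= n /\
    isomorphic (theta [:: p; q; r]) (theta [:: 2; 2; n.*2])).
  constructor 3; exists n; split=> // /isomorphic_card.
  rewrite !card_theta_vertex3; move: simple; rewrite /theta_simple /=; lia.
constructor 2; exists p, q, r; split=> //; first exact: isomorphic_refl.
by move=> n n1 iso; apply: none; exists n.
Qed.

(** A theta graph arises from paths with common ends that are otherwise
    disjoint; [ss] lists their inner vertices. *)
Lemma theta_of_paths (a b : T) (ss : seq (seq T)) :
    uniq [:: a, b & flatten ss] -> all (fun s => path e a (rcons s b)) ss ->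
  contains_subgraph e (theta [seq (size s).+1 | s <- ss]).
Proof.
set ps := [seq _ | s <- ss]; move=> /= /and3P[anb bss uss] paths.
have lt_ss (i : 'I_(size ps)) : i < size ss.
  by rewrite -[X in _ < X](size_map (fun s => (size s).+1)).
have psE (i : 'I_(size ps)) : nth 0 ps i = (size (nth [::] ss i)).+1.
  by rewrite (nth_map [::]).
have shE (i : 'I_(size ps)) : nth 0 (shape ss) i = (nth 0 ps i).-1.
  by rewrite psE (nth_map [::]).
pose h (x : theta_vertex ps) := match x with
  | inl false => a | inl true => b
  | inr u => nth a (flatten ss) (flatten_index (shape ss) (tag u) (tagged u)) end.
have ltf (i : 'I_(size ps)) (k : 'I_(nth 0 ps i).-1) :
    flatten_index (shape ss) i k < size (flatten ss).
  by rewrite size_flatten flatten_indexP // shE.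
have hpt (i : 'I_(size ps)) k : k <= nth 0 ps i ->
    h (theta_pt i k) = nth b (a :: rcons (nth [::] ss i) b) k.
  case: k => // k ltk; have [lt|ge] := ltnP k (nth 0 ps i).-1.
    rewrite theta_pt_inner /= nth_flatten flatten_indexKl ?flatten_indexKr ?shE //.
    by rewrite nth_rcons; move: lt; rewrite psE /= => lt; rewrite lt (set_nth_default b).
  have -> : k.+1 = nth 0 ps i by rewrite psE in ltk ge *; lia.
  by rewrite theta_pt_end ?psE //= nth_rcons ltnn eqxx.
have aF : a \notin flatten ss by move: anb; rewrite inE negb_or => /andP[].
have inner u : h (inr u) \in flatten ss by apply: mem_nth; apply: ltf.
exists h.
- move=> [[]|u] [[]|w] //=; rewrite -1?/(h (inr _)).
  + by move=> ba; rewrite ba inE eqxx in anb.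
  + by move=> bw; have := inner w; rewrite -bw (negbTE bss).
  + by move=> ab; rewrite ab inE eqxx in anb.
  + by move=> aw; have := inner w; rewrite -aw; rewrite (negbTE aF).
  + by move=> bu; have := inner u; rewrite bu (negbTE bss).
  + by move=> au; have := inner u; rewrite au; rewrite (negbTE aF).
  case: u w => [i k] [j l] /= /eqP; rewrite nth_uniq //; try exact: ltf.
  move=> /eqP E; congr inr.
  have kE : k < nth 0 (shape ss) i by rewrite shE.
  have lE : l < nth 0 (shape ss) j by rewrite shE.
  have ij : i = j by apply/val_inj; rewrite -[val i](flatten_indexKl kE) E flatten_indexKl.
  subst j; congr existT; apply/val_inj.
  by rewrite -[val k](flatten_indexKr kE) E flatten_indexKr.
have arc (i : 'I_(size ps)) (k : 'I_(nth 0 ps i)) :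
    e (h (theta_pt i k)) (h (theta_pt i k.+1)).
  rewrite !hpt //; last exact: ltnW.
  have /pathP := allP paths _ (mem_nth [::] (lt_ss i)); apply.
  by rewrite size_rcons -psE.
move=> x y /existsP[i /existsP[k /orP[]/andP[/eqP-> /eqP->]]] //.
by rewrite e_sym.
Qed.


End Families.

(** * Cycles and ears *)

Section Structure.
Variables (T : finType) (e : rel T).
Hypotheses (e_sym : symmetric e) (e_irr : irreflexive e).
Variable c : T -> bool.
Hypothesis col : forall x y, e x y -> c x != c y.
Hypothesis no_F234 : ~ contains_F234 e.
Implicit Types (A : {set T}) (a b x y z : T) (s p q : seq T).

(** All degrees in [A] are at least 2; here [u] is the vertex from which a walk
    has just reached [v], and [w] is a way to go on. *)
Definition min_degree2 A :=
  forall v u, v \in A -> exists2 w, w \in A & (w != u) && e v w.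

Lemma two_steps x y z : e x y -> e y z -> c x = c z.
Proof. by move=> /col + /col; case: (c x) (c y) (c z) => [] [] []. Qed.

Lemma path_rev a b s : path e a (rcons s b) = path e b (rcons (rev s) a).
Proof.
have := rev_path e a (rcons s b).
rewrite last_rcons belast_rcons rev_cons => ->.
by apply: eq_path => x y; rewrite e_sym.
Qed.

(** Extending a path as long as possible, one ends in a vertex all of whose
    neighbors lie on the path; one of them is not its predecessor. *)
Lemma back_edge A x p :
    min_degree2 A -> path e x p -> uniq (x :: p) -> {subset x :: p <= A} ->
  exists q i, let w := x :: p ++ q in
    [/\ path e x (p ++ q), uniq w, {subset w <= A}, i + 2 < size w
      & e (last x (p ++ q)) (nth x w i)].
Proof.
move=> deg2; have [n] := ubnP (#|T| - size p).
elim: n p => // n IHn p ltn paths up pA.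
have [/exists_inP[y yA /andP[yp ezy]]|/exists_inPn maxp] :=
    boolP [exists y in A, (y \notin x :: p) && e (last x p) y].
  have uy : uniq (x :: rcons p y) by rewrite -rcons_cons rcons_uniq yp.
  have [||//||q [i]] := IHn (rcons p y).
  - have : size (x :: rcons p y) <= #|T| by rewrite -(card_uniqP uy) max_card.
    move: ltn; rewrite /= size_rcons; move: #|T| (size p) => N k; lia.
  - by rewrite rcons_path paths.
  - by move=> u; rewrite -rcons_cons mem_rcons inE => /predU1P[->|/pA].
  by rewrite cat_rcons; exists (y :: q), i.
set z := last x p in maxp.
have zA : z \in A by apply/pA/mem_last.
have [y yA /andP[yu ezy]] := deg2 z (nth x (x :: p) (size p).-1) zA.
have yp : y \in x :: p by have := maxp y yA; rewrite ezy andbT negbK.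
exists [::], (index y (x :: p)); rewrite cats0; split; rewrite ?nth_index //.
have zE : z = nth x (x :: p) (size p) by rewrite nth_last.
have lt : index y (x :: p) < (size p).+1 by rewrite -[X in _ < X]/(size (x :: p)) index_mem.
have ne1 : index y (x :: p) != size p.
  apply: contraTneq ezy => ip; have -> : y = z by rewrite zE -ip nth_index.
  by rewrite e_irr.
have ne2 : index y (x :: p) != (size p).-1.
  by apply: contra_neq yu => <-; rewrite nth_index.
by rewrite [size _]/=; lia.
Qed.

Lemma cycle_exists A x : min_degree2 A -> x \in A ->
  exists s, [/\ uniq s, cycle e s, 2 < size s & {subset s <= A}].
Proof.
move=> deg2 xA; have [|||q [i]] := @back_edge A x [::] deg2.
- by [].
- by [].
- by move=> y; rewrite inE => /eqP->.
rewrite /=; set w := x :: q => -[pq uw wA lti elast].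
have dropE : drop i w = nth x w i :: drop i.+1 w by apply: drop_nth; rewrite /=; lia.
exists (drop i w); split.
- exact: drop_uniq.
- have : sorted e (drop i w) by apply: drop_sorted.
  rewrite dropE /= rcons_path => ->; suff -> : last (nth x w i) (drop i q) = last x q by [].
  have := last_cat x (take i w) (drop i w).
  by rewrite cat_take_drop dropE /= => ->.
- by rewrite size_drop /=; lia.
- by move=> y /mem_drop/wA.
Qed.

(** Let an edge leave a cycle.  Continuing along it as far as possible, one
    finally meets either the path just walked, which makes a dumbbell, or the
    cycle, which makes a theta graph.  Hence it is [theta_{2,2,2}]. *)
Lemma ear A x s d :
    min_degree2 A -> uniq (x :: s) -> cycle e (x :: s) -> 1 < size s ->
    {subset x :: s <= A} -> d \in A -> d \notin x :: s -> e x d ->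
  exists v0 v1 v2, s = [:: v0; v1; v2] /\ e d v1.
Proof.
move=> deg2 us cyc szs sA dA ds exd.
have [v0 [t sE]] : exists v0 t, s = v0 :: t by case: (s) szs => // v0 t; exists v0, t.
have uw0 : uniq (rcons (rcons s x) d).
  by rewrite !rcons_uniq mem_rcons ds -cons_uniq us.
have pt : path e v0 (rcons (rcons t x) d).
  rewrite rcons_path last_rcons exd andbT.
  by move: cyc; rewrite sE /= => /andP[].
have [||q [i]] := @back_edge A v0 (rcons (rcons t x) d) deg2 pt.
- by move: uw0; rewrite sE.
- move=> y; rewrite -!rcons_cons -sE mem_rcons inE => /predU1P[-> //|].
  by rewrite mem_rcons => /sA.
rewrite -cat_cons -!rcons_cons -sE cat_rcons cat_rcons.
set w := s ++ [:: x, d & q]; case=> pw uw wA lti elast.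
have szw : size w = size s + (size q).+2 by rewrite size_cat.
have sw : sorted e w by move: pw; rewrite /w sE cat_rcons cat_rcons.
have arcw k : k.+1 < size w -> e (nth v0 w k) (nth v0 w k.+1).
  by move/sortedP: sw; apply.
have lastw : last v0 (rcons (rcons t x) d ++ q) = nth v0 w (size w).-1.
  by rewrite nth_last /w sE cat_rcons cat_rcons.
rewrite {}lastw in elast.
have nthx : nth v0 w (size s) = x by rewrite nth_cat ltnn subnn.
(* The walk comes back to itself: the cycle followed by the walk lists the
   vertices of a dumbbell. *)
have [ltis|leis] := ltnP i (size s); last first.
  exfalso; apply: no_F234.
  have n3 : 2 < size w - i by clear -lti; lia.
  have NE : (size s).+1 + (i - size s).+1 + (size w - i) - 2 = size w.
    by clear -leis lti; lia.
  have iE : (size s).+1 + (i - size s).+1 - 2 = i by clear -leis; lia.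
  have zE : (size s).+1 + (i - size s).+1 + (size w - i) - 3 = (size w).-1.
    by clear -NE; lia.
  have k1 : 0 < (i - size s).+1 by [].
  have m3 : 2 < (size s).+1 by [].
  apply: (dumbbell_contains_F234 m3 k1 n3).
  apply/(dumbbellP e_sym m3 k1 n3).
  exists (nth v0 w); rewrite /dumbbell_at NE; split=> //.
  - by move=> k l ltk ltl /eqP; rewrite nth_uniq // => /eqP.
  - have -> : nth v0 w 0 = v0 by rewrite /w sE.
    by rewrite nthx e_sym; move: cyc; rewrite sE /= => /andP[].
  - by rewrite iE zE e_sym.
(* The walk comes back to the cycle, in a vertex [y]. *)
set y := nth v0 w i in elast.
have [pre [mid spl]] : exists pre mid, s = pre ++ y :: mid.
  exists (take i s), (drop i.+1 s); rewrite -{1}(cat_take_drop i s) (drop_nth v0) //.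
  by rewrite /y nth_cat ltis.
have wE : w = pre ++ y :: mid ++ [:: x, d & q] by rewrite /w spl -catA.
have lastE : nth v0 w (size w).-1 = last d q by rewrite nth_last wE last_cat /= last_cat.
rewrite {}lastE in elast.
have p1 : path e y (rcons mid x).
  move: sw; rewrite wE; case: (pre) => [|z pre'] /=.
    by rewrite -cat_rcons cat_path => /andP[].
  by rewrite cat_path -cat_rcons /= cat_path => /and3P[_ _ /andP[]].
have p2 : path e y (rcons (rev pre) x).
  rewrite -path_rev; move: cyc; rewrite spl /= -cats1 -catA cat_path rcons_path.
  by case/andP=> -> /= /andP[].
have pdq : path e d q.
  move: sw; rewrite wE; case: (pre) => [|z pre'] /=; rewrite cat_path /=.
    by case/andP=> _ /and3P[].
  by case/and3P=> _ _; rewrite cat_path /= => /and4P[].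
have p3 : path e y (rcons (rev (d :: q)) x).
  by rewrite -path_rev /= exd rcons_path pdq.
have uss : uniq [:: y, x & flatten [:: mid; rev pre; rev (d :: q)]].
  rewrite (@perm_uniq _ _ w) //; apply/permP => P.
  by rewrite wE /= cats0 !count_cat !count_rev /= !count_cat /=; clear; lia.
have sub : contains_subgraph e (theta [:: (size mid).+1; (size pre).+1; (size q).+2]).
  have := theta_of_paths e_sym uss; rewrite /= !size_rev; apply.
  by rewrite p1 p2 p3.
have szE : size s = size pre + (size mid).+1 by rewrite spl size_cat.
have sz2 : size pre + size mid + size q = 2.
  have [//|ne] := eqVneq (size pre + size mid + size q) 2; exfalso; apply: no_F234.
  apply: theta_contains_F234 sub; rewrite /theta_simple /=; clear -ne szE szs; lia.
have even2 u u' v : e u u' -> e u' v -> e v u -> False.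
  by move=> e1 e2 /col; rewrite (two_steps e1 e2) eqxx.
(* Among the remaining sizes only one is compatible with the coloring. *)
have sz1 : 0 < size pre + size mid by clear -szE szs; lia.
move: sz2 sz1 spl p1 p2 elast; clearbody y; clear -e_sym exd even2.
case: q => [|d' [|d'' q]] sz2 sz1 spl p1 p2 elast; last 1 first.
- by exfalso; clear -sz1 sz2; rewrite /= in sz2; lia.
- have nyx : ~ e y x by move=> eyx; apply: even2 exd elast eyx.
  case: pre sz2 sz1 spl p1 p2 => [|v0 pre] sz2 sz1 spl p1 p2.
    by move: p2; rewrite /= andbT => /nyx.
  case: mid sz2 sz1 spl p1 p2 => [|v2 mid] sz2 sz1 spl p1 p2.
    by move: p1; rewrite /= andbT => /nyx.
  rewrite /= in sz2; have pre0 : pre = [::] by apply: size0nil; clear -sz2; lia.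
  have mid0 : mid = [::] by apply: size0nil; clear -sz2; lia.
  by exists v0, y, v2; rewrite spl pre0 mid0.
have nxa a : e y a -> e a x -> e y x -> False.
  by move=> eya eax; rewrite e_sym; apply: even2 eya eax.
case: pre sz2 sz1 spl p1 p2 => [|v0 pre] sz2 sz1 spl p1 p2; rewrite /= in sz2 sz1 p1 p2.
  case: mid sz2 sz1 spl p1 p2 => [//|v2 mid] sz2 sz1 spl p1 p2; rewrite /= in sz2 p1.
  have mid0 : mid = [::] by apply: size0nil; clear -sz2; lia.
  move: p1 p2; rewrite mid0 /= !andbT => /andP[ev2 ev2x] eyx.
  by case: (nxa v2).
have pre0 : pre = [::] by apply: size0nil; clear -sz2; lia.
have mid0 : mid = [::] by apply: size0nil; clear -sz2; lia.
move: p1 p2; rewrite pre0 mid0 /= !andbT => eyx /andP[ev0 ev0x].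
by case: (nxa v0).
Qed.


(** A chord splits a cycle into a theta graph with a path of length 1. *)
Lemma chordless s : uniq s -> cycle e s -> 2 < size s ->
  {in s &, forall x y, e x y -> y = next s x \/ x = next s y}.
Proof.
move=> us cs szs x y xs ys exy.
have [i s' rotE] := rot_to xs.
rewrite -(next_rot i us) -(next_rot i us y) rotE.
have us' : uniq (x :: s') by rewrite -rotE rot_uniq.
have cs' : cycle e (x :: s') by rewrite -rotE rot_cycle.
have szs' : 2 < size (x :: s') by rewrite -rotE size_rot.
have {ys} ys' : y \in s'.
  move: ys; rewrite -(mem_rot i) rotE inE => /predU1P[yx|//].
  by rewrite yx e_irr in exy.
have [pre [mid s'E]] : exists pre mid, s' = pre ++ y :: mid.
  by case/splitPr: ys' => pre mid; exists pre, mid.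
subst s'; move: us' cs' szs'; clear - exy e_sym col no_F234 => us cs szs.
case: pre us cs szs => [|v0 pre] us cs szs.
  by left; rewrite next_nth mem_head /= eqxx.
case: mid us cs szs => [|v1 mid] us cs szs.
  right; have E : x :: (v0 :: pre) ++ [:: y] = rcons (x :: v0 :: pre) y by rewrite -cats1.
  rewrite E in us *; have yn : y \notin x :: v0 :: pre.
    by move: us; rewrite rcons_uniq => /andP[].
  have idx : index y (rcons (x :: v0 :: pre) y) = size (rcons (v0 :: pre) y).
    by rewrite -cats1 index_cat (negbTE yn) index_head addn0 size_rcons.
  by rewrite next_nth mem_rcons mem_head idx rcons_cons nth_default.
exfalso; set pre' := v0 :: pre in us cs szs; set mid' := v1 :: mid in us cs szs.
have p1 : path e y (rcons mid' x).
  by move: cs; rewrite /cycle rcons_cat cat_path => /andP[_ /andP[]].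
have p2 : path e y (rcons (rev pre') x).
  rewrite -path_rev rcons_path; move: cs; rewrite /cycle rcons_cat cat_path.
  by case/andP=> -> /andP[].
have odd_path s : size s = 1 -> ~~ path e y (rcons s x).
  case: s => [|v [|//]] //= _; rewrite andbT; apply/negP => /andP[eyv evx].
  by have := col exy; rewrite (two_steps eyv evx) eqxx.
have sz1 : size mid' != 1 by apply: contraTneq p1; apply: odd_path.
have sz2 : size pre' != 1.
  by apply: contraTneq p2 => sz; apply: odd_path; rewrite size_rev.
apply: no_F234.
apply: (@theta_contains_F234 _ e 1 (size mid').+1 (size pre').+1).
- by rewrite /theta_simple.
- by clear -sz1 sz2; rewrite /= in sz1 sz2 *; lia.
have uss : uniq [:: y, x & flatten [:: [::]; mid'; rev pre']].
  rewrite (@perm_uniq _ _ (x :: pre' ++ y :: mid')) //; apply/permP => P.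
  by rewrite /= cats0 !count_cat !count_rev /=; clear; lia.
have := theta_of_paths e_sym uss; rewrite [map _ _]/= size_rev; apply.
by apply/and4P; split=> //; rewrite /= [e y x]e_sym exy.
Qed.

Definition closed_in A (Q : {set T}) := {in Q & A, forall x y, e x y -> y \in Q}.

(** If no edge leaves a cycle, it is the part sought for.  Otherwise there are
    two vertices [a] and [b] with three common neighbors, and these two form
    such a part together with all their common neighbors: by the lemma on ears
    an edge leaving it either leads to a further common neighbor of [a] and
    [b], or produces a [K_{3,3}], which contains [theta_{1,3,3}]. *)
Lemma cycle_or_biclique A : A != set0 -> min_degree2 A ->
  exists Q : {set T}, [/\ Q \subset A, Q != set0, closed_in A Q &
    (exists s, [/\ Q = [set x in s], uniq s, cycle e s & 2 < size s]) \/
    (exists a b, biclique2 e Q a b /\ 4 < #|Q|)].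
Proof.
case/set0Pn=> x0 x0A deg2.
have [s [us cs szs sA]] := cycle_exists deg2 x0A.
have [/exists_inP[a as_ /exists_inP[d dA /andP[ds ead]]]|/exists_inPn clos] :=
    boolP [exists x in s, exists d in A, (d \notin s) && e x d]; last first.
  exists [set x in s]; split; [| |move=> x y|by left; exists s].
  - by apply/subsetP => x; rewrite inE => /sA.
  - by case: (s) szs => // x s' _; apply/set0Pn; exists x; rewrite inE mem_head.
  - rewrite !inE => xs yA exy; have /exists_inPn/(_ y yA) := clos x xs.
    by rewrite exy andbT negbK.
have ear_at x t z : uniq (x :: t) -> cycle e (x :: t) -> 1 < size t ->
    {subset x :: t <= A} -> z \in A -> z \notin x :: t -> e x z ->
  exists v0 v1 v2, t = [:: v0; v1; v2] /\ e z v1 by apply: ear.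
have [v0 [b [v2 [uv cv vA dv edb]]]] : exists v0 b v2,
    [/\ uniq [:: a; v0; b; v2], cycle e [:: a; v0; b; v2],
        {subset [:: a; v0; b; v2] <= A}, d \notin [:: a; v0; b; v2] & e d b].
  have [i t rotE] := rot_to as_.
  have mem_t : a :: t =i s by move=> x; rewrite -rotE mem_rot.
  have [|||||v0 [b [v2 [tE edb]]]] := ear_at a t d _ _ _ _ dA _ ead.
  - by rewrite -rotE rot_uniq.
  - by rewrite -rotE rot_cycle.
  - by have := size_rot i s; rewrite rotE /=; lia.
  - by move=> x; rewrite mem_t; apply: sA.
  - by rewrite mem_t.
  exists v0, b, v2; rewrite -tE; split=> //; rewrite -?rotE ?rot_uniq ?rot_cycle //.
    by move=> x; rewrite mem_rot; apply: sA.
  by rewrite mem_rot.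
pose S := [set x in A | e a x && e b x]; pose Q := [set a; b] :|: S.
have [aA v0A bA v2A] : [/\ a \in A, v0 \in A, b \in A & v2 \in A].
  by split; apply: vA; rewrite !inE eqxx ?orbT.
move: cv; rewrite /= andbT => /and4P[eav0 ev0b ebv2 ev2a].
have v0S : v0 \in S by rewrite inE v0A eav0 e_sym.
have v2S : v2 \in S by rewrite inE v2A ebv2 e_sym ev2a.
have dS : d \in S by rewrite inE dA ead e_sym.
have ab : a != b by move: uv; rewrite /= !inE !negb_or => /and3P[/and3P[]].
have cab : c a = c b by apply: two_steps eav0 ev0b.
have cS x : x \in S -> c x = ~~ c a.
  by rewrite inE => /andP[_ /andP[/col + _]]; case: (c a) (c x) => [] [].
have abQ x : x \in [set a; b] -> c x = c a by case/set2P=> ->.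
have uS3 : uniq [:: v0; v2; d].
  move: uv dv; rewrite /= !inE !negb_or !andbT.
  case/and3P=> _ /andP[_ v02] _ /and4P[_ dv0 _ dv2].
  by rewrite v02 [v0 == d]eq_sym [v2 == d]eq_sym dv0 dv2.
have opposite u1 u2 u3 u4 z : uniq [:: u1; u2; u3; u4] ->
    [/\ e u1 u2, e u2 u3, e u3 u4 & e u4 u1] -> {subset [:: u1; u2; u3; u4] <= A} ->
    z \in A -> z \notin [:: u1; u2; u3; u4] -> e u1 z -> e z u3.
  move=> uu [e12 e23 e34 e41] uA zA zn e1z.
  have cu : cycle e [:: u1; u2; u3; u4] by rewrite /= e12 e23 e34 e41.
  by have [v [w [v' [[_ <- _]]]]] := ear_at u1 [:: u2; u3; u4] z uu cu isT uA zA zn e1z.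
have SP x : x \in S -> [/\ x \in A, e a x, e b x, e x a & e x b].
  by rewrite inE => /andP[xA /andP[eax ebx]]; rewrite ![e x _]e_sym.
have SQ x : x \in S -> x \in Q by move=> xS; rewrite inE xS orbT.
have nS x : x \in S ->
    [/\ (a == x) = false, (b == x) = false, (x == a) = false & (x == b) = false].
  move/SP=> [_ eax ebx _ _]; rewrite ![x == _]eq_sym.
  have ax : a != x by apply: contraTneq eax => ->; rewrite e_irr.
  have bx : b != x by apply: contraTneq ebx => ->; rewrite e_irr.
  by rewrite (negbTE ax) (negbTE bx).
have aQ : a \in Q by rewrite !inE eqxx.
have bQ : b \in Q by rewrite !inE eqxx orbT.
have no_leave z x : z \in A -> z \notin Q -> x \in Q -> ~~ e x z.
  move=> zA zQ xQ; apply/negP => exz.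
  have zn u : u \in Q -> z != u by move=> uQ; apply: contraNneq zQ => ->.
  have zn4 u1 u2 u3 u4 : u1 \in Q -> u2 \in Q -> u3 \in Q -> u4 \in Q ->
      z \notin [:: u1; u2; u3; u4].
    by move=> /zn z1 /zn z2 /zn z3 /zn z4; rewrite !inE !negb_or z1 z2 z3 z4.
  have A4 u1 u2 u3 u4 : u1 \in A -> u2 \in A -> u3 \in A -> u4 \in A ->
      {subset [:: u1; u2; u3; u4] <= A}.
    by move=> A1 A2 A3 A4' u; rewrite !inE => /or4P[]/eqP->.
  have v02 : v0 != v2 by move: uS3; rewrite /= !inE negb_or => /andP[/andP[]].
  have [_ eav0' ebv0 ev0a ev0b'] := SP v0 v0S; have [_ eav2 ebv2' ev2a' ev2b] := SP v2 v2S.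
  have [nv01 nv02 nv03 nv04] := nS v0 v0S; have [nv21 nv22 nv23 nv24] := nS v2 v2S.
  have zS : e a z -> e b z -> False.
    by move=> eaz ebz; case/negP: zQ; apply: SQ; rewrite inE zA eaz.
  case/setUP: xQ exz => [/set2P[->|->] exz|xS exz].
  - suff ezb : e z b by apply: (zS exz); rewrite e_sym.
    apply: (opposite a v0 b v2 z _ _ _ zA _ exz) => //.
    by apply: zn4 => //; apply: SQ.
  - suff eza : e z a by apply: (zS _ exz); rewrite e_sym.
    apply: (opposite b v0 a v2 z _ _ _ zA _ exz) => //; last 2 first.
    + exact: A4.
    + by apply: zn4 => //; apply: SQ.
    by rewrite /= !inE nv02 [b == a]eq_sym (negbTE ab) nv21 nv03 (negbTE v02) nv22.
  have [y [y' [yS y'S yy' xy xy']]] : exists y y',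
      [/\ y \in S, y' \in S, y != y', x != y & x != y'].
    move: uS3; rewrite /= !inE !negb_or => /andP[/andP[_ v0d] /andP[v2d _]].
    have [->|xv0] := eqVneq x v0; first by exists v2, d.
    have [->|xv2] := eqVneq x v2.
      by exists v0, d; split=> //; rewrite eq_sym.
    by exists v0, v2.
  have [xA eax ebx exa exb] := SP x xS; have [x1 x2 x3 x4] := nS x xS.
  have adj y1 : y1 \in S -> x != y1 -> e z y1.
    move=> y1S xy1; have [y1A eay1 eby1 ey1a ey1b] := SP y1 y1S.
    have [n1 n2 n3 n4] := nS y1 y1S.
    apply: (opposite x a y1 b z _ _ _ zA _ exz) => //; last 2 first.
    + exact: A4.
    + by apply: zn4 => //; apply: SQ.
    by rewrite /= !inE x3 (negbTE xy1) x4 n1 (negbTE ab) n4.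
  have [yA eay eby eya eyb] := SP y yS; have [y1 y2 y3 y4] := nS y yS.
  have [y'A eay' eby' ey'a ey'b] := SP y' y'S; have [y'1 y'2 y'3 y'4] := nS y' y'S.
  have [za zb zx] := And3 (zn a aQ) (zn b bQ) (zn x (SQ x xS)).
  have [zy zy'] := conj (zn y (SQ y yS)) (zn y' (SQ y' y'S)).
  apply: no_F234; apply: (@theta_contains_F234 _ e 1 3 3) => //.
  apply: (@theta_of_paths _ e e_sym a y [:: [::]; [:: x; b]; [:: y'; z]]).
    rewrite /= !inE !negb_or y1 x1 ab y'1 [a == z]eq_sym za [y == x]eq_sym xy y4 yy'.
    rewrite [y == z]eq_sym zy x4 xy' [x == z]eq_sym zx y'2 [b == z]eq_sym zb.
    by rewrite [y' == z]eq_sym zy'.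
  by rewrite /= eay eax exb eby eay' [e y' z]e_sym !adj.
exists Q; split.
- rewrite !subUset !sub1set aA bA; apply/subsetP => x.
  by rewrite inE => /andP[].
- by apply/set0Pn; exists a.
- by move=> x y xQ yA exy; apply: contraTT exy => yQ; apply: no_leave.
right; exists a, b; split; first split=> // x y xQ yQ.
- have [xab|xab] := boolP (x \in [set a; b]); have [yab|yab] := boolP (y \in [set a; b]).
  + by apply/negbTE/negP => /col; rewrite (abQ x xab) (abQ y yab) eqxx.
  + have yS : y \in S by move: yQ; rewrite inE (negbTE yab).
    by have [_ eay eby _ _] := SP y yS; case/set2P: xab => ->.
  + have xS : x \in S by move: xQ; rewrite inE (negbTE xab).
    by have [_ _ _ exa exb] := SP x xS; case/set2P: yab => ->.
  have xS : x \in S by move: xQ; rewrite inE (negbTE xab).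
  have yS : y \in S by move: yQ; rewrite inE (negbTE yab).
  by apply/negbTE/negP => /col; rewrite (cS x xS) (cS y yS) eqxx.
have [n1 n2 _ _] := nS v0 v0S; have [n3 n4 _ _] := nS v2 v2S; have [n5 n6 _ _] := nS d dS.
have u5 : uniq [:: a; b; v0; v2; d].
  by rewrite cons_uniq cons_uniq uS3 !inE (negbTE ab) n1 n2 n3 n4 n5 n6.
rewrite -[4.+1]/(size [:: a; b; v0; v2; d]) -(card_uniqP u5).
apply: subset_leq_card; apply/subsetP => x.
by rewrite !in_cons orbF => /or4P[|||/orP[]] /eqP-> //; apply: SQ.
Qed.

End Structure.

(** * Decomposition into components and pendant vertices *)

Section Decomposition.
Variables (T : finType) (e : rel T).
Hypotheses (e_sym : symmetric e) (e_irr : irreflexive e).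
Implicit Types (A B Q : {set T}) (a b x y z : T) (c : T -> bool).

Definition degree_in A v := #|[set w in A | e v w]|.

(** In a bipartite graph the cycle is even; a [K_{2,n}] with more than four
    vertices is not a cycle itself. *)
Definition even_cycle_or_biclique Q :=
  (exists s, [/\ Q = [set x in s], uniq s, cycle e s & 2 < size s]) \/
  (exists a b, biclique2 e Q a b /\ 4 < #|Q|).

Lemma degree_in_min_degree2 A :
  {in A, forall v, 1 < degree_in A v} -> min_degree2 e A.
Proof.
move=> deg v u /deg/card_gt1P[x [y []]]; rewrite !inE.
move=> /andP[xA evx] /andP[yA evy] xy.
have [xu|xu] := eqVneq x u; last by exists x; rewrite ?xu.
by exists y; rewrite // evy andbT -xu eq_sym.
Qed.

(** As long as there is a vertex of degree at most 1, it is taken off;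
    otherwise some cycle or [K_{2,n}] is a union of components. *)
Lemma decomposition_ind c (P : {set T} -> Prop) :
    (forall x y, e x y -> c x != c y) -> ~ contains_F234 e ->
    P set0 ->
    (forall A v, v \notin A -> degree_in A v <= 1 -> P A -> P (v |: A)) ->
    (forall A Q, [disjoint A & Q] ->
       (forall x y, x \in A -> y \in Q -> ~~ e x y) ->
       even_cycle_or_biclique Q -> P A -> P (A :|: Q)) ->
  forall A, P A.
Proof.
move=> col noF P0 Pleaf Punion A.
have [n] := ubnP #|A|; elim: n A => // n IHn A ltA.
have [/exists_inP[v vA degv]|/exists_inPn deg] :=
    boolP [exists v in A, degree_in A v <= 1].
  rewrite -(setD1K vA); apply: Pleaf; first by rewrite !inE eqxx.
    apply: leq_trans degv; apply: subset_leq_card; apply/subsetP => w.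
    by rewrite !inE => /andP[/andP[_ ->]].
  by apply: IHn; move: ltA; rewrite (cardsD1 v A) vA.
have [->//|A0] := eqVneq A set0.
have deg2 : min_degree2 e A.
  by apply: degree_in_min_degree2 => v /deg; rewrite -ltnNge.
have [Q [sQA Q0 clQ partQ]] := cycle_or_biclique e_sym e_irr col noF A0 deg2.
have -> : A = (A :\: Q) :|: Q by rewrite setUC -{1}(setIidPr sQA) setID.
apply: Punion => //.
- by rewrite disjoint_subset; apply/subsetP => x /setDP[].
- move=> x y /setDP[xA xQ] yQ; apply: contra xQ; rewrite e_sym.
  by move=> eyx; apply: clQ eyx.
- apply: IHn; apply: leq_trans (_ : #|A| <= n) => //; apply: proper_card.
  rewrite properE subsetDl; case/set0Pn: Q0 => x xQ.
  by apply/subsetPn; exists x; rewrite ?(subsetP sQA) // inE xQ.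
Qed.

Lemma cycle_win2 c s r :
    (forall x y, e x y -> c x != c y) -> ~ contains_F234 e ->
    uniq s -> cycle e s -> 2 < size s ->
  win e r [set x in s] (fun=> 2).
Proof.
move=> col noF us cs szs; apply: (@cycle_win _ e r c) => //.
  by move=> x y _ _; apply: col.
exact: (chordless e_sym e_irr col noF).
Qed.

Lemma win_of_parts c r :
    (forall x y, e x y -> c x != c y) -> ~ contains_F234 e ->
    (forall Q a b, biclique2 e Q a b -> 4 < #|Q| -> win e r Q (fun=> 2)) ->
  forall A, win e r A (fun=> 2).
Proof.
move=> col noF winQ; apply: (decomposition_ind col noF).
- by apply: win_stable => [|v]; [apply/stableP => x y|]; rewrite inE.
- by move=> A v vA deg winA; apply: win_add_vertex.
move=> A Q disj sep partQ winA; apply: win_union => //.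
case: partQ => [[s [-> us cs szs]]|[a [b [KQ leQ]]]]; last exact: winQ KQ leQ.
exact: cycle_win2 col noF us cs szs.
Qed.

Lemma biclique2_not_paintable_in4 Q a b :
  biclique2 e Q a b -> 5 < #|Q| -> ~ paintable_in e (fun=> 2) 4.
Proof.
case=> aQ bQ ab eQ ltQ; set S := Q :\: [set a; b].
have : 3 < size (enum S).
  rewrite -cardE; have : #|[set a; b]| = 2 by rewrite cards2 ab.
  have /setIidPr sI : [set a; b] \subset Q by rewrite subUset !sub1set aQ bQ.
  by move=> c2; rewrite /S cardsD sI c2; lia.
have SE x : x \in enum S -> e x a && e x b.
  rewrite mem_enum => /setDP[xQ xab].
  by rewrite !eQ // (negbTE xab) !inE !eqxx orbT.
have := enum_uniq (mem S).
case: (enum S) SE => [|x1 [|x2 [|x3 [|x4 s]]]] // SE us _.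
apply: (lister_wins_four_rounds e_irr ab (x13 := x1) (x14 := x2) (x23 := x3) (x24 := x4)).
  by move: us; rewrite -[_ :: _]/([:: x1; x2; x3; x4] ++ s) cat_uniq => /andP[].
by move=> x xs; apply: SE; rewrite -[_ :: _]/([:: x1; x2; x3; x4] ++ s) mem_cat xs.
Qed.

(** * The core *)

Definition prune A := [set v in A | degree_in A v != 1].

Lemma core_setE : core_set e = iter #|T| prune setT.
Proof. by []. Qed.

Lemma prune_subset A : prune A \subset A.
Proof. by apply/subsetP => v; rewrite inE => /andP[]. Qed.

(** Every pruning step that changes the set deletes a vertex, so the iteration
    has become stationary after [#|T|] steps. *)
Lemma prune_core : prune (core_set e) = core_set e.
Proof.
have step n : #|iter n prune setT| <= #|T| - n \/
    prune (iter n prune setT) = iter n prune setT.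
  elim: n => [|n [IH|IH]]; first by left; rewrite subn0 max_card.
    have [E|ne] := eqVneq (prune (iter n prune setT)) (iter n prune setT).
      by right; rewrite iterS !E.
    left; rewrite iterS; have : #|prune (iter n prune setT)| < #|iter n prune setT|.
      by apply: proper_card; rewrite properEneq ne prune_subset.
    by move: IH; move: #|T| #|_| #|_| => k l m; lia.
  by right; rewrite iterS !IH.
rewrite core_setE; case: (step #|T|) => //; rewrite subnn leqn0 cards_eq0.
move=> /eqP->; apply/eqP; rewrite -subset0; exact: prune_subset.
Qed.

(** The vertices deleted simultaneously in a pruning step can be put back one
    by one, and none of them then has degree more than 1. *)
Lemma core_ind (P : {set T} -> Prop) :
    (forall A v, v \notin A -> degree_in A v <= 1 -> P A -> P (v |: A)) ->
  P (core_set e) -> P setT.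
Proof.
move=> Pleaf; rewrite core_setE; elim: #|T| => // n IHn PA; apply: IHn.
move: PA; rewrite iterS; move: (iter n prune setT) => A PA.
suff fill (B : {set T}) : prune A \subset B -> B \subset A -> P B.
  exact: fill (prune_subset A) (subxx A).
have [n'] := ubnP #|B|; elim: n' B => // n' IH B ltB sAB sBA.
have [<-//|] := eqVneq (prune A) B; rewrite eqEsubset sAB /= => /subsetPn[v vB vA].
rewrite -(setD1K vB); apply: Pleaf; first by rewrite !inE eqxx.
  have : degree_in A v = 1.
    by apply/eqP; move: vA; rewrite inE (subsetP sBA) //= negbK.
  move=> <-; apply: subset_leq_card; apply/subsetP => w; rewrite !inE.
  by case/andP=> /andP[_ wB] ->; rewrite (subsetP sBA).
apply: IH.
- by move: ltB; rewrite (cardsD1 v B) vB.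
- apply/subsetP => w wA; rewrite !inE (subsetP sAB) // andbT.
  by apply: contraNneq vA => <-.
- exact: subset_trans (subsetDl B [set v]) sBA.
Qed.

Lemma bipartite_core c :
  coloring_on e (core_set e) c -> bipartite e.
Proof.
move=> col; suff [c' col'] : exists c', coloring_on e setT c'.
  by exists c' => x y; apply: col'; rewrite inE.
apply: (core_ind (P := fun A => exists c', coloring_on e A c')); last by exists c.
move=> A v vA deg [c' col'].
have [k kv] : exists k : bool, {in A, forall w, e v w -> c' w = k}.
  have [/exists_inP[w wA evw]|/exists_inPn none] := boolP [exists w in A, e v w].
    exists (c' w) => w' w'A evw'; congr c'; move/card_le1_eqP: deg; apply;
    by rewrite inE ?wA ?w'A.
  by exists true => w /none/negbTE->.
exists (fun x => if x == v then ~~ k else c' x) => x y.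
have other z : z \in A -> (z == v) = false by move=> zA; apply: contraNF vA => /eqP<-.
case/setU1P=> [->|xA] /setU1P[->|yA]; rewrite ?eqxx ?e_irr //.
- by rewrite other // => /(kv _ yA)->; case: k kv.
- by rewrite other // e_sym => /(kv _ xA)->; case: k kv.
- by rewrite !other //; apply: col'.
Qed.

(** Connectedness is expressed by the absence of proper nonempty closed parts.
    A vertex removed by a pruning step has a single neighbor, and it is put
    back to the part that contains this neighbor. *)
Lemma prune_connected A :
    (forall Q, Q \subset A -> Q != set0 -> closed_in e A Q -> Q = A) ->
  forall Q, Q \subset prune A -> Q != set0 -> closed_in e (prune A) Q -> Q = prune A.
Proof.
move=> connA Q sQ Q0 clQ; have sQA := subset_trans sQ (prune_subset A).
pose L := [set v in A :\: prune A | [exists x in Q, e v x]].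
have E : Q :|: L = A.
  apply: connA.
  - rewrite subUset sQA; apply/subsetP => v.
    by case/setIdP=> /setDP[].
  - by case/set0Pn: Q0 => x xQ; apply/set0Pn; exists x; rewrite inE xQ.
  move=> x y /setUP[xQ|xL] yA exy.
    have [yP|yP] := boolP (y \in prune A); first by rewrite inE (clQ x y).
    rewrite !inE yA; apply/orP; right; move: yP; rewrite inE yA /= => -> /=.
    by apply/exists_inP; exists x; rewrite // e_sym.
  case/setIdP: xL => /setDP[xA xP] /exists_inP[z zQ exz].
  have deg1 : degree_in A x = 1 by apply/eqP; move: xP; rewrite inE xA negbK.
  suff -> : y = z by rewrite inE zQ.
  have /eqP/cards1P[w wE] := deg1.
  have : y \in [set w] by rewrite -wE inE yA.
  have : z \in [set w] by rewrite -wE inE (subsetP sQA).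
  by move=> /set1P-> /set1P->.
apply/eqP; rewrite eqEsubset sQ; apply/subsetP => x xP.
have : x \in Q :|: L by rewrite E (subsetP (prune_subset A)).
by case/setUP=> // /setIdP[/setDP[_]]; rewrite xP.
Qed.

Lemma core_connected : connected e ->
  forall Q, Q \subset core_set e -> Q != set0 -> closed_in e (core_set e) Q ->
  Q = core_set e.
Proof.
move=> conn; rewrite core_setE; elim: #|T| => [|n IHn]; last exact: prune_connected.
move=> Q _ /set0Pn[x xQ] clQ; apply/setP => y; rewrite inE.
have cl : closed e (mem Q).
  apply: (intro_closed (sym_connect_sym e_sym)) => u v euv uQ.
  by apply: clQ euv; rewrite ?inE.
by rewrite -(closed_connect cl (conn x y)).
Qed.

Lemma biclique2_isomorphic Q a b :
  biclique2 e Q a b -> isomorphic (induced e Q) (K2 (#|Q| - 2)).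
Proof.
move=> KQ; have [aQ bQ ab eQ] := KQ; set S := Q :\: [set a; b].
have cS : #|S| = #|Q| - 2.
  have /setIidPr sI : [set a; b] \subset Q by rewrite subUset !sub1set aQ bQ.
  by rewrite /S cardsD sI cards2 ab.
have gt2 : 2 <= #|Q|.
  have -> : 2 = #|[set a; b]| by rewrite cards2 ab.
  by rewrite subset_leq_card // subUset !sub1set aQ bQ.
rewrite -cS; pose g (u : 'I_2 + 'I_#|S|) : T :=
  match u with inl i => if i == 0 :> nat then a else b | inr j => enum_val j end.
have gS j : enum_val j \in S := enum_valP j.
have gQ u : g u \in Q.
  case: u => [i|j] /=; first by case: ifP.
  by have /setDP[] := gS j.
have gl u : (g u \in [set a; b]) = is_inl u.
  case: u => [i|j] /=; first by case: ifP; rewrite !inE eqxx ?orbT.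
  by have /setDP[_ /negbTE] := gS j.
have inj_g : injective g.
  move=> u u' E; have := gl u; rewrite E gl; move: u u' E.
  move=> [[[|[|//]] lti]|j] [[[|[|//]] lti']|j'] //= E _;
    try by congr inl; apply: val_inj.
  - by rewrite E eqxx in ab.
  - by rewrite E eqxx in ab.
  - by congr inr; apply: enum_val_inj.
pose g' u : {x | x \in Q} := Sub (g u) (gQ u).
have inj_g' : injective g' by move=> u u' /(congr1 val) /inj_g.
have bij_g' : bijective g'.
  apply: inj_card_bij => //; rewrite card_sum !card_ord card_sig.
  by rewrite cS subnKC // (eq_card (_ : _ =i mem Q)) // => x; rewrite inE.
have [h g'K hK] := bij_g'; exists h; first by exists g'.
move=> x y; rewrite /induced -{2}(hK x) -{2}(hK y) /= eQ ?gQ // !gl.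
by [].
Qed.

Lemma isomorphic_biclique2 n Q :
  isomorphic (induced e Q) (K2 n) -> #|Q| = n + 2 /\ exists a b, biclique2 e Q a b.
Proof.
case=> h bij_h iso; split.
  have := bij_eq_card bij_h; rewrite card_sum !card_ord card_sig addnC => <-.
  by apply: eq_card => x; rewrite inE.
have [g hK gK] := bij_h.
pose a := val (g (inl ord0)); pose b := val (g (inl ord_max)).
have lab x (xQ : x \in Q) : (x \in [set a; b]) = is_inl (h (Sub x xQ)).
  rewrite !inE; have E u : (x == val (g u)) = (h (Sub x xQ) == u).
    by rewrite -[RHS](can_eq gK) hK.
  rewrite !E; case: (h _) => [[[|[|//]] lti]|j] //=.
exists a, b; split; try exact: valP.
  by rewrite (inj_eq val_inj) (can_eq gK).
move=> x y xQ yQ; rewrite (lab x xQ) (lab y yQ).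
by have := iso (Sub x xQ) (Sub y yQ); rewrite /induced /= => <-.
Qed.

End Decomposition.

(** * The values of m *)

Section Values.
Variables (T : finType) (e : rel T).
Hypotheses (e_sym : symmetric e) (e_irr : irreflexive e).

Lemma bipartite_paintable_in2 : bipartite e -> paintable_in e (fun=> 2) 2.
Proof.
case=> c col; apply: win_paintable_in; apply: (@win_two_rounds _ _ _ c) => //.
by move=> x y _ _; apply: col.
Qed.

Lemma noF234_paintable_in3 :
  bipartite e -> ~ contains_F234 e -> paintable_in e (fun=> 2) 3.
Proof.
case=> c col noF; apply: win_paintable_in.
apply: (win_of_parts e_sym e_irr col noF) => Q a b KQ _.
exact: (biclique2_win3 KQ).
Qed.

Lemma noF234_not_paintable_in4 :
    bipartite e -> ~ contains_F234 e -> ~ paintable e (fun=> 2) ->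
  ~ paintable_in e (fun=> 2) 4.
Proof.
case=> c col noF notp p4; apply: notp; apply: win_paintable => r.
apply: (win_of_parts e_sym e_irr col noF) => Q a b KQ _.
apply: (biclique2_win e_irr r KQ) => //; rewrite leqNgt; apply/negP => gt5.
exact: (biclique2_not_paintable_in4 e_irr KQ gt5).
Qed.

Lemma core_biclique :
    bipartite e -> ~ contains_F234 e -> connected e -> ~ paintable e (fun=> 2) ->
  in_F5 (core e).
Proof.
case=> c col noF conn notp.
have notwin : ~ forall r, win e r (core_set e) (fun=> 2).
  move=> wins; apply: notp; apply: win_paintable => r.
  apply: (@core_ind _ e (fun A => win e r A (fun=> 2))) => // A v vA deg.
  exact: win_add_vertex.
have whole := core_connected e_sym conn.
have deg_ne1 v : v \in core_set e -> degree_in e (core_set e) v != 1.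
  by rewrite -{1}(prune_core e) inE => /andP[].
set K := core_set e in notwin whole deg_ne1 *.
have [K0|K0] := eqVneq K set0.
  case: notwin => r; apply: win_stable => //.
  by apply/stableP => x y; rewrite K0 inE.
have deg_pos v : v \in K -> 0 < degree_in e K v.
  move=> vK; rewrite lt0n; apply/negP; rewrite cards_eq0 => /eqP deg0.
  have no_nbr y : y \in K -> ~~ e v y.
    move=> yK; apply/negP => evy.
    by have : y \in [set w in K | e v w]; [rewrite inE yK | rewrite deg0 inE].
  have vE : [set v] = K.
    apply: whole; rewrite ?sub1set //; first by apply/set0Pn; exists v; rewrite inE.
    by move=> x y /set1P-> /no_nbr/negbTE->.
  case: notwin => r; rewrite -vE; apply: win_stable => //.
  by apply/stableP => x y /set1P-> /set1P->; rewrite e_irr.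
have deg2 : min_degree2 e K.
  apply: degree_in_min_degree2 => v vK.
  by have := deg_ne1 v vK; have := deg_pos v vK; case: degree_in => [|[]].
have [Q [sQK Q0 clQ partQ]] := cycle_or_biclique e_sym e_irr col noF K0 deg2.
have QK := whole Q sQK Q0 clQ; subst Q.
case: partQ => [[s [sE us cs szs]]|[a [b [KK gt4]]]].
  by case: notwin => r; rewrite sE; apply: (cycle_win2 e_sym e_irr r col noF).
exists (#|K| - 2); last exact: (biclique2_isomorphic KK).
have : 5 < #|K|.
  by rewrite ltnNge; apply/negP => le5; case: notwin => r; apply: (biclique2_win e_irr r KK).
by rewrite ltn_subRL.
Qed.

Lemma core_biclique_m_is4 : in_F5 (core e) -> m_is e 4.
Proof.
case=> n n4 /isomorphic_biclique2[cardK [a [b KK]]].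
have bip : bipartite e by apply: bipartite_core (biclique2_coloring KK).
have gt5 : 5 < #|core_set e| by rewrite cardK addn2 !ltnS.
split=> //; first exact: (biclique2_not_paintable_in4 e_irr KK gt5).
case=> [|[|[|[|//]]]] // _; first exact: bipartite_paintable_in2.
apply: win_paintable_in; apply: (@core_ind _ e (fun A => win e 3 A (fun=> 2))).
  by move=> A v vA deg; apply: win_add_vertex.
exact: (biclique2_win3 KK).
Qed.

End Values.

Theorem theorem15 (T : finType) (e : rel T) (e_sym : symmetric e)
    (e_irr : irreflexive e) (e_not2p : ~ paintable e (fun=> 2)) :
  [/\ [\/ m_is e 2, m_is e 3 | m_is e 4],
      (m_is e 2 <-> ~ bipartite e),
      (m_is e 3 <-> bipartite e /\ contains_F234 e)
    & ((m_is e 4 -> connected e -> in_F5 (core e))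
       /\ (in_F5 (core e) -> m_is e 4))].
Proof.
have m2 : m_is e 2 <-> ~ bipartite e.
  split=> [[_ not2 _] /bipartite_paintable_in2 //|notbip].
  by split=> [//|/paintable_in2_bipartite //|s]; case: s => [|[|]].
have m3 : m_is e 3 <-> bipartite e /\ contains_F234 e.
  split=> [[_ not3 lt3]|[bip sub]].
    have bip := paintable_in2_bipartite (lt3 2 isT); split=> //.
    by apply: NNPP => noF; apply: not3; apply: noF234_paintable_in3.
  split=> [//||s]; first exact: F234_not_paintable_in3.
  by case: s => [|[|[|]]] // _; apply: bipartite_paintable_in2.
split=> //; last first.
  split=> [[_ _ lt4] conn|]; last exact: core_biclique_m_is4.
  have bip := paintable_in2_bipartite (lt4 2 isT).
  apply: core_biclique => // sub.
  exact: (F234_not_paintable_in3 e_sym bip sub (lt4 3 isT)).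
have [bip|notbip] := classic (bipartite e); last by constructor 1; apply/m2.
have [sub|noF] := classic (contains_F234 e); first by constructor 2; apply/m3.
constructor 3; split=> //; first exact: noF234_not_paintable_in4.
case=> [|[|[|[|//]]]] // _; first exact: bipartite_paintable_in2.
exact: noF234_paintable_in3.
Qed.
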